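(* Let $K$ be a field, $S=K[x_1,\ldots,x_n]$, and let $I\subset S$ be a homogeneous ideal with linear quotients with respect to $f_1,\ldots,f_m$ (in this order), where $\{f_1,\ldots,f_m\}$ is a minimal system of homogeneous generators for $I$. For $p=1,\ldots,m$ let $n_p$ be the minimal number of homogeneous generators of the ideal $\langle f_1,\ldots,f_{p-1}\rangle : f_p$. Then $$\operatorname{reg}(I)=\max\{\deg(f_p) : p=1,\ldots,m\},$$ $$\operatorname{projdim}(I)=\max\{n_p : 1\leq p\leq m\},$$ and, for all $i$ and $j$, $$\beta_{i,i+j}(I)=\sum_{1\leq p\leq m,\ \deg(f_p)=j}\binom{n_p}{i},\qquad \beta_i(I)=\sum_{p=1}^m\binom{n_p}{i}.$$
   Context: $S=K[x_1,\ldots,x_n]$ is the polynomial ring over a field $K$ with its standard grading. If $\{f_1,\ldots,f_m\}$ is a system of homogeneous generators of a homogeneous ideal $I\subset S$, then $I$ has linear quotients with respect to the elements $f_1,\ldots,f_m$ if the ideal $\langle f_1,\ldots,f_{i-1}\rangle : f_i$ is generated by linear forms for all $i=2,\ldots,m$ (this property depends on the order of the generators). For $p=1$, the ideal $\langle f_1,\ldots,f_{p-1}\rangle$ is the zero ideal, so $n_1=0$. $\beta_{i,i+j}(I)=\dim_K\operatorname{Tor}_i^S(K,I)_{i+j}$ are the graded Betti numbers of $I$, $\beta_i(I)=\sum_j\beta_{i,i+j}(I)$ are its total Betti numbers, $\operatorname{reg}(I)$ is its Castelnuovo-Mumford regularity and $\operatorname{projdim}(I)$ its projective dimension as an $S$-module.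 *)

(* Defs.v *)
From Stdlib Require Import ClassicalEpsilon.
From HB Require Import structures.
From mathcomp Require Import all_boot all_order all_algebra.
From mathcomp.multinomials Require Export mpoly.

Set Implicit Arguments.
Unset Strict Implicit.
Unset Printing Implicit Defensive.

Import Order.TTheory GRing.Theory Num.Theory.
Local Open Scope ring_scope.

Section Ideals.
Variables (K : fieldType) (n : nat).
Local Notation S := {mpoly K[n]}.

Definition is_ideal (I : S -> Prop) : Prop :=
  [/\ I 0, (forall g h, I g -> I h -> I (g + h)) &
      (forall s g, I g -> I (s * g))].

Definition homogeneous_ideal (I : S -> Prop) : Prop :=
  is_ideal I /\ (forall g d, I g -> I (pihomog mdeg d g)).

(* The ideal generated by the [f t] such that [P t]. *)
Definition ideal_span (T : finType) (P : pred T) (f : T -> S) : S -> Prop :=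
  fun g => exists c : T -> S, g = \sum_(t | P t) c t * f t.

Definition colon (J : S -> Prop) (h : S) : S -> Prop := fun g => J (g * h).

Definition homogeneous_generators (I : S -> Prop) (m : nat) (f : 'I_m -> S) :
    Prop :=
  (forall p, f p \is homog mdeg) /\
  (forall g, I g <-> ideal_span predT f g).

Definition minimal_homogeneous_generators (I : S -> Prop) (m : nat)
    (f : 'I_m -> S) : Prop :=
  homogeneous_generators I f /\
  (forall A : {set 'I_m}, A \proper [set: 'I_m] ->
     ~ (forall g, I g <-> ideal_span (mem A) f g)).

(* The indices are shifted: [f p], for [p] in {0, ..., m-1}, is f_{p+1}. *)
Definition prev_colon (m : nat) (f : 'I_m -> S) (p : 'I_m) : S -> Prop :=
  colon (ideal_span (fun q : 'I_m => (q < p)%N) f) (f p).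

Definition generated_by_linear_forms (J : S -> Prop) : Prop :=
  exists (k : nat) (l : 'I_k -> S),
    (forall t, l t \is 1.-homog) /\ (forall g, J g <-> ideal_span predT l g).

Definition linear_quotients (I : S -> Prop) (m : nat) (f : 'I_m -> S) : Prop :=
  homogeneous_generators I f /\
  (forall p : 'I_m, (0 < p)%N -> generated_by_linear_forms (prev_colon f p)).

Definition is_min_number_generators (J : S -> Prop) (k : nat) : Prop :=
  (exists g : 'I_k -> S, homogeneous_generators J g) /\
  (forall (k' : nat) (g : 'I_k' -> S), homogeneous_generators J g ->
     (k <= k')%N).

(* Only meaningful for nonzero [f]. *)
Definition deg (f : S) : nat := (msize f).-1.

End Ideals.

Section Betti.
Variables (K : fieldType) (n : nat).
Local Notation S := {mpoly K[n]}.

(* A sequence of graded free modules of finite rank, F_i being the direct sum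
   over k of the S(- fshift i k), with maps F_{i+1} -> F_i and F_0 -> S given
   by right multiplication of row vectors. *)
Record graded_free_seq := GradedFreeSeq {
  frank : nat -> nat;
  fshift : forall i : nat, 'I_(frank i) -> int;
  fdiff : forall i : nat, 'M[S]_(frank i.+1, frank i);
  faug : 'cV[S]_(frank 0) }.

Definition zero_free_seq : graded_free_seq :=
  @GradedFreeSeq (fun _ => 0%N) (fun _ _ => 0) (fun _ => 0) 0.

(* ... -> F_1 -> F_0 -> I -> 0 is exact and all the maps have degree 0. *)
Definition is_graded_free_resolution (F : graded_free_seq) (I : S -> Prop) :
    Prop :=
  [/\ (forall i k l, forall m, m \in msupp (fdiff F i k l) ->
         (mdeg m)%:Z + fshift l = fshift k)
      /\ (forall k, forall m, m \in msupp (faug F k 0) ->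
         (mdeg m)%:Z = fshift k),
      (forall g : S, I g <-> exists v : 'rV[S]_(frank F 0),
         (v *m faug F) 0 0 = g),
      (forall v : 'rV[S]_(frank F 0),
         v *m faug F = 0 <-> exists w, v = w *m fdiff F 0) &
      (forall i (v : 'rV[S]_(frank F i.+1)),
         v *m fdiff F i = 0 <-> exists w, v = w *m fdiff F i.+1)].

(* K (x)_S F_i is K^(frank i), and the maps of K (x)_S F are obtained by
   reducing the entries of [fdiff] modulo the ideal (x_1, ..., x_n). *)
Definition tensor_diff (F : graded_free_seq) (i : nat) :
    'M[K]_(frank F i.+1, frank F i) :=
  map_mx (mcoeff 0%MM) (fdiff F i).

(* Subspaces of K^(frank i) are represented by row spaces of matrices; this is
   the component of degree d of K (x)_S F_i. *)
Definition tensor_component (F : graded_free_seq) (i : nat) (d : int) :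
    'M[K]_(frank F i) :=
  diag_mx (\row_k (fshift k == d)%:R).

Definition tensor_cycles (F : graded_free_seq) (i : nat) (d : int) :
    'M[K]_(frank F i) :=
  match i with
  | 0 => tensor_component F 0 d
  | i'.+1 => (tensor_component F i'.+1 d :&: kermx (tensor_diff F i'))%MS
  end.

Definition tensor_boundaries (F : graded_free_seq) (i : nat) (d : int) :
    'M[K]_(frank F i.+1, frank F i) :=
  tensor_component F i.+1 d *m tensor_diff F i.

(* dim_K of the component of degree d of H_i(K (x)_S F). *)
Definition dim_tensor_homology (F : graded_free_seq) (i : nat) (d : int) : nat :=
  (\rank (tensor_cycles F i d) - \rank (tensor_boundaries F i d))%N.

(* Every homogeneous ideal has a graded free resolution of this kind, by the
   Noetherian property of S. *)
Definition chosen_resolution (I : S -> Prop) : graded_free_seq :=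
  epsilon (inhabits zero_free_seq) (fun F => is_graded_free_resolution F I).

(* [betti I i d] is dim_K Tor_i(K, I)_d, so that beta_{i,i+j}(I) is
   [betti I i (i%:Z + j)]. *)
Definition betti (I : S -> Prop) (i : nat) (d : int) : nat :=
  dim_tensor_homology (chosen_resolution I) i d.

(* [b] is the sum over all integers j of beta_{i,i+j}(I), a sum with finitely
   many nonzero terms. *)
Definition is_total_betti (I : S -> Prop) (i b : nat) : Prop :=
  exists s : seq int,
    [/\ uniq s, (forall j : int, betti I i (i%:Z + j) <> 0%N -> j \in s) &
        b = (\sum_(j <- s) betti I i (i%:Z + j))%N].

(* r = max {j : beta_{i,i+j}(I) <> 0 for some i} *)
Definition is_regularity (I : S -> Prop) (r : int) : Prop :=
  (exists i : nat, betti I i (i%:Z + r) <> 0%N) /\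
  (forall (i : nat) (j : int), betti I i (i%:Z + j) <> 0%N -> j <= r).

End Betti.

Section ProjectiveDimension.

Definition projective (R : nzRingType) (P : lmodType R) : Prop :=
  forall (M N : lmodType R) (q : {linear M -> N}) (h : {linear P -> N}),
    (forall y, exists x, q x = y) ->
    exists h' : {linear P -> M}, forall x, q (h' x) = h x.

Variables (K : fieldType) (n : nat).
Local Notation S := {mpoly K[n]}.

(* 0 -> P_d -> ... -> P_0 -> I -> 0 is exact; the surjection P_0 -> I is seen
   as a map to S with image I. *)
Definition has_projective_resolution (I : S -> Prop) (d : nat) : Prop :=
  exists (P : nat -> lmodType S) (D : forall i, {linear P i.+1 -> P i})
    (e : {linear P 0%N -> S^o}),
    [/\ (forall i, projective (P i)) /\
        (forall i, (d < i)%N -> forall x : P i, x = 0),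
        (forall g : S, I g <-> exists x, e x = g),
        (forall x, e x = 0 <-> exists y, x = D 0%N y) &
        (forall i (x : P i.+1), D i x = 0 <-> exists y, x = D i.+1 y)].

Definition is_projective_dimension (I : S -> Prop) (d : nat) : Prop :=
  has_projective_resolution I d /\
  (forall d', has_projective_resolution I d' -> (d <= d')%N).

End ProjectiveDimension.

(* Main.v *)
(** Let J_p be generated by f_1, ..., f_(p-1) and let L_p = J_p : f_p. From
    0 -> J_p -> J_(p+1) -> (S/L_p)(-deg f_p) -> 0, a free resolution of J_(p+1)
    is the mapping cone of a map from the Koszul resolution of S/L_p to the
    resolution of J_p, and the claims can be read off from its shifts once it is
    known to be minimal. The degrees of the f_p may decrease, so that minimality
    is not automatic: a constant in the comparison map has to lie in the strand
    of degree deg f_p + 1. In homological degree 0 it would make some f_q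
    redundant. Above, the constants form a vector killed by the linear part of
    the differential, and this linear part is injective on constants, being
    block triangular with Koszul differentials on the diagonal.

    The Koszul resolution itself is obtained by the same cones: independent
    linear forms l_1, ..., l_r satisfy (l_1, ..., l_(p-1)) : l_p =
    (l_1, ..., l_(p-1)). *)

Require Import Defs.
From Stdlib Require Import ClassicalEpsilon.
From HB Require Import structures.
From mathcomp Require Import all_boot all_order all_algebra.
From mathcomp Require Import zify ring.

Set Implicit Arguments.
Unset Strict Implicit.
Unset Printing Implicit Defensive.

Import Order.TTheory GRing.Theory Num.Theory.
Local Open Scope ring_scope.

(** * Comparison of projective resolutions *)

(** Chain maps and homotopies are built degree by degree with it: [P] is the invariant that makes
    the next choice possible, [Q] the relation between consecutive choices. *)
Lemma dependent_choice_nat (T : nat -> Type) (P : forall i, T i -> Prop)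
    (Q : forall i, T i -> T i.+1 -> Prop) :
  (exists x, P 0%N x) ->
  (forall i x, P i x -> exists y, P i.+1 y /\ Q i x y) ->
  exists s : forall i, T i,
    (forall i, P i (s i)) /\ (forall i, Q i (s i) (s i.+1)).
Proof.
move=> P0 PS.
have [x0 Px0] := constructive_indefinite_description _ P0.
pose step i (x : {x | P i x}) : {y | P i.+1 y /\ Q i (sval x) y} :=
  constructive_indefinite_description _ (PS i _ (proj2_sig x)).
pose s := nat_rect (fun i => {x : T i | P i x}) (exist _ x0 Px0)
  (fun i x => exist _ (sval (step i x)) (proj1 (proj2_sig (step i x)))).
exists (fun i => sval (s i)); split=> i; first exact: proj2_sig (s i).
exact: (proj2 (proj2_sig (step i (s i)))).
Qed.

(** * Lifting from projective modules along maps that need not be onto *)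

Section ImageSubmodule.
Variables (R : nzRingType) (M N : lmodType R) (q : {linear M -> N}).

(** Submodules need a boolean membership predicate, which excluded middle provides. *)
Definition image_pred : pred N :=
  fun y => excluded_middle_informative (exists x, y = q x).

Lemma image_predP y : reflect (exists x, y = q x) (y \in image_pred).
Proof.
by rewrite unfold_in /image_pred; case: excluded_middle_informative=> h;
  constructor.
Qed.

Lemma image_submod_closed : submod_closed image_pred.
Proof.
split; first by apply/image_predP; exists 0; rewrite linear0.
move=> a _ _ /image_predP[x ->] /image_predP[y ->]; apply/image_predP.
by exists (a *: x + y); rewrite linearP.
Qed.

HB.instance Definition _ :=
  GRing.isSubmodClosed.Build R N image_pred image_submod_closed.

Record image_submodule :=
  ImageSubmodule { image_val :> N; image_valP : image_val \in image_pred }.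
HB.instance Definition _ := [isSub for image_val].
HB.instance Definition _ := [Choice of image_submodule by <:].
HB.instance Definition _ := [SubChoice_isSubLmodule of image_submodule by <:].

Definition into_image (P : lmodType R) (h : {linear P -> N})
    (hq : forall x, h x \in image_pred) : P -> image_submodule :=
  fun x => ImageSubmodule (hq x).

Lemma into_image_is_linear P h hq : linear (@into_image P h hq).
Proof. by move=> a x y; apply: val_inj; rewrite linearP /= linearP. Qed.

HB.instance Definition _ P h hq :=
  GRing.isLinear.Build R P image_submodule _ (@into_image P h hq)
    (@into_image_is_linear P h hq).

(** [projective] speaks of surjections, so both [q] and [h] are corestricted to the image of [q]. *)
Lemma projective_lift (P : lmodType R) (h : {linear P -> N}) :
  projective P -> (forall x, exists y, h x = q y) ->
  exists h' : {linear P -> M}, forall x, q (h' x) = h x.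
Proof.
move=> projP hq.
have hqP x : h x \in image_pred by apply/image_predP.
have qP y : q y \in image_pred by apply/image_predP; exists y.
have [|h' h'E] := projP _ _ (@into_image M q qP : {linear _ -> _})
    (@into_image P h hqP : {linear _ -> _}).
  case=> y yP; have /image_predP[x yE] := yP.
  by exists x; apply: val_inj; rewrite /= yE.
by exists h' => x; have /(congr1 val) := h'E x.
Qed.

End ImageSubmodule.

Section Comparison.
Variables (R : nzRingType) (E : lmodType R).
Variables (P : nat -> lmodType R) (D : forall i, {linear P i.+1 -> P i}).
Variables (e : {linear P 0%N -> E}).
Variables (Q : nat -> lmodType R) (D' : forall i, {linear Q i.+1 -> Q i}).
Variables (e' : {linear Q 0%N -> E}).
Hypothesis projP : forall i, projective (P i).
Hypothesis eD : forall x, e (D 0 x) = 0.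
Hypothesis DD : forall i x, D i (D i.+1 x) = 0.
Hypothesis exact_e' : forall x, e' x = 0 -> exists y, x = D' 0 y.
Hypothesis exact_D' : forall i x, D' i x = 0 -> exists y, x = D' i.+1 y.

(** The comparison theorem for a complex of projectives and an exact target: each component is
    obtained by lifting the previous one, composed with [D], along [D']. *)
Lemma lift_chain_map : (forall x, exists y, e x = e' y) ->
  exists phi : forall i, {linear P i -> Q i},
    (forall x, e' (phi 0%N x) = e x) /\
    (forall i x, D' i (phi i.+1 x) = phi i (D i x)).
Proof.
move=> im; pose T i := {linear P i -> Q i}.
(* The first clause is what the next lift requires; the augmentation condition concerns degree 0
   alone, hence the match. *)
pose Inv i (u : T i) : Prop :=
  (forall x, exists y, u (D i x) = D' i y) /\
  match i return T i -> Prop with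
  | 0 => fun u => forall x, e' (u x) = e x
  | _ => fun _ => True
  end u.
pose Rel i (u : T i) (v : T i.+1) := forall x, D' i (v x) = u (D i x).
have [||phi [Iphi Rphi]] := @dependent_choice_nat T Inv Rel.
- have [u uE] := projective_lift (@projP 0%N) im.
  by exists u; split=> // x; apply: exact_e'; rewrite uE.
- move=> i u [Iu _].
  have [v vE] := @projective_lift _ _ _ (D' i) _ (u \o D i : {linear _ -> _})
    (@projP i.+1) Iu.
  exists v; split=> //; split=> // x; apply: exact_D'.
  by rewrite vE /= DD linear0.
by exists phi; split=> //; exact: (Iphi 0%N).2.
Qed.

(** The part of [chi] not yet accounted for by the homotopy is a cycle, hence a boundary, and lifts
    along [D']. *)
Lemma null_homotopy (chi : forall i, {linear P i -> Q i}) :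
  (forall x, e' (chi 0%N x) = 0) ->
  (forall i x, D' i (chi i.+1 x) = chi i (D i x)) ->
  exists h : forall i, {linear P i -> Q i.+1},
    (forall x, chi 0%N x = D' 0 (h 0%N x)) /\
    (forall i x, chi i.+1 x = h i (D i x) + D' i.+1 (h i.+1 x)).
Proof.
move=> chi0 chiS; pose T i := {linear P i -> Q i.+1}.
pose Inv i (u : T i) : Prop :=
  (forall x, D' i (chi i.+1 x - u (D i x)) = 0) /\
  match i return T i -> Prop with
  | 0 => fun u => forall x, chi 0%N x = D' 0 (u x)
  | _ => fun _ => True
  end u.
pose Rel i (u : T i) (v : T i.+1) :=
  forall x, chi i.+1 x = u (D i x) + D' i.+1 (v x).
have [||h [Ih Rh]] := @dependent_choice_nat T Inv Rel.
- have [u uE] := projective_lift (@projP 0%N) (fun x => exact_e' (chi0 x)).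
  by exists u; split=> // x; rewrite linearB chiS uE subrr.
- move=> i u [Iu _].
  have [v vE] := @projective_lift _ _ _ (D' i.+1) _
    (chi i.+1 \- (u \o D i) : {linear _ -> _}) (@projP i.+1)
    (fun x => exact_D' (Iu x)).
  have vE' x : chi i.+1 x = u (D i x) + D' i.+1 (v x).
    by rewrite vE /= addrC subrK.
  exists v; split=> //; split=> // x.
  by rewrite linearB chiS vE' DD linear0 add0r subrr.
by exists h; split=> //; exact: (Ih 0%N).2.
Qed.

End Comparison.

(** * Homogeneous components *)

Section Homogeneous.
Variables (K : fieldType) (n : nat).
Local Notation S := {mpoly K[n]}.

(** Degrees are integers because the entries of a graded matrix have differences of shifts as
    degrees. Zero has every degree and is alone in negative ones. *)
Definition hom_deg (z : int) (g : S) : Prop :=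
  forall m, m \in msupp g -> (mdeg m)%:Z = z.

Definition hcomp (z : int) (g : S) : S :=
  if z is Posz d then pihomog mdeg d g else 0.

Lemma mcoeff_hcomp z (g : S) m :
  (hcomp z g)@_m = if (mdeg m)%:Z == z then g@_m else 0.
Proof.
case: z => [d|d] /=; last by rewrite mcoeff0.
rewrite /pihomog raddf_sum /=.
under eq_bigr do rewrite mcoeffZ mcoeffX.
rewrite big_mkcond /=; have [gm|gm] := boolP (m \in msupp g); last first.
  rewrite (memN_msupp_eq0 gm) if_same big_seq big1 // => m' m'g.
  case: ifP => // _; have [mE|_] := eqVneq m' m; last by rewrite mulr0.
  by case/negP: gm; rewrite -mE.
rewrite (bigD1_seq m) ?msupp_uniq //= big1 ?addr0; last first.
  by move=> m' /negPf ->; rewrite mulr0 if_same.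
by rewrite eqxx mulr1.
Qed.

Lemma hom_degE z (g : S) m : hom_deg z g -> (mdeg m)%:Z != z -> g@_m = 0.
Proof.
by move=> hg mz; apply: memN_msupp_eq0; apply/negP=> /hg /eqP; apply/negP.
Qed.

Lemma hom_deg_hcomp z (g : S) : hom_deg z (hcomp z g).
Proof.
by move=> m; rewrite mcoeff_msupp mcoeff_hcomp; case: ifP => [/eqP //|_ /eqP].
Qed.

Lemma hcomp_id z (g : S) : hom_deg z g -> hcomp z g = g.
Proof.
move=> hg; apply/mpolyP=> m; rewrite mcoeff_hcomp.
by case: ifPn => // /(hom_degE hg).
Qed.

Lemma hcomp_is_additive z : zmod_morphism (hcomp z).
Proof. by case: z => d g h /=; rewrite ?subr0 // pihomogB. Qed.
HB.instance Definition _ z :=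
  GRing.isZmodMorphism.Build S S (hcomp z) (hcomp_is_additive z).

Lemma hcompMr z e (g h : S) :
  hom_deg e h -> hcomp (z + e) (g * h) = hcomp z g * h.
Proof.
move=> hh; apply/mpolyP=> m; rewrite mcoeff_hcomp !mcoeffM.
(* Where [h] has a nonzero coefficient, the degree of a product of monomials determines that of the
   first factor, so both sides keep the same terms of the convolution. *)
have dE (k1 k2 : 'X_{1..n}) : m == (k1 + k2)%MM -> h@_k2 != 0 ->
    ((mdeg m)%:Z == z + e) = ((mdeg k1)%:Z == z).
  move=> /eqP -> hk; have <- : (mdeg k2)%:Z = e by apply/hh; rewrite mcoeff_msupp.
  by rewrite mdegD PoszD (inj_eq (addIr _)).
case: ifPn => mz; [|symmetry; apply: big1 => k km]; last first.
  rewrite mcoeff_hcomp; have [->|/(dE _ _ km) <-] := eqVneq h@_k.2 0.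
    by rewrite mulr0.
  by rewrite (negPf mz) mul0r.
apply: eq_bigr => k km; rewrite mcoeff_hcomp.
have [->|/(dE _ _ km) <-] := eqVneq h@_k.2 0; first by rewrite !mulr0.
by rewrite mz.
Qed.

Lemma hcompMl z e (g h : S) :
  hom_deg e h -> hcomp (e + z) (h * g) = h * hcomp z g.
Proof. by move=> hh; rewrite addrC mulrC hcompMr // mulrC. Qed.

Lemma hom_deg_ext z z' (g : S) : hom_deg z g -> z = z' -> hom_deg z' g.
Proof. by move=> ? <-. Qed.

Lemma hom_degM z e (g h : S) :
  hom_deg z g -> hom_deg e h -> hom_deg (z + e) (g * h).
Proof.
by move=> hg hh; rewrite -(hcomp_id hg) -(hcompMr _ _ hh); exact: hom_deg_hcomp.
Qed.

Lemma hom_deg0 z : hom_deg z 0.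
Proof. by move=> m; rewrite msupp0. Qed.

Lemma hom_degN z (g : S) : hom_deg z g -> hom_deg z (- g).
Proof. by move=> hg m; rewrite (perm_mem (msuppN g)); exact: hg. Qed.

Lemma hom_deg_sum (T : finType) (P : pred T) z (F : T -> S) :
  (forall t, P t -> hom_deg z (F t)) -> hom_deg z (\sum_(t | P t) F t).
Proof.
move=> hF; suff <- : hcomp z (\sum_(t | P t) F t) = \sum_(t | P t) F t.
  exact: hom_deg_hcomp.
by rewrite raddf_sum; apply: eq_bigr => t Pt; rewrite /= hcomp_id //; exact: hF.
Qed.

Lemma hom_deg_const0 z (g : S) : hom_deg z g -> z != 0 -> g@_0%MM = 0.
Proof. by move=> hg z0; apply: (hom_degE hg); rewrite mdeg0 eq_sym. Qed.

Lemma hom_deg_neg z (g : S) : hom_deg z g -> z < 0 -> g = 0.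
Proof.
by move=> hg; rewrite -(hcomp_id hg); case: z {hg} => //= d; rewrite ltz_nat.
Qed.

Lemma hom_deg0_const (g : S) : hom_deg 0 g -> g = (g@_0%MM)%:MP.
Proof.
move=> hg; apply/mpolyP=> m; rewrite mcoeffC.
have [->|m0] := eqVneq m 0%MM; first by rewrite mulr1.
by rewrite mulr0 (hom_degE hg) // eqz_nat mdeg_eq0.
Qed.

Lemma dhomog_hom_deg d (g : S) : g \is d.-homog -> hom_deg d%:Z g.
Proof. by move=> /dhomogP hg m /hg ->. Qed.

Lemma homog_hom_deg (g : S) : g \is homog mdeg -> hom_deg (deg g)%:Z g.
Proof. by rewrite homog_msize => /dhomog_hom_deg. Qed.

(** Acting on row vectors, these are the degree 0 maps from $\bigoplus_i S(-a_i)$ to $\bigoplus_j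
    S(-b_j)$. *)
Definition graded p q (a : 'I_p -> int) (b : 'I_q -> int) (A : 'M[S]_(p, q)) :=
  forall i j, hom_deg (a i - b j) (A i j).

Definition hcomp_mx p q (a : 'I_p -> int) (b : 'I_q -> int) (A : 'M[S]_(p, q)) :
  'M[S]_(p, q) := \matrix_(i, j) hcomp (a i - b j) (A i j).

Lemma gradedP p q (a : 'I_p -> int) (b : 'I_q -> int) (A : 'M[S]_(p, q)) :
  graded a b A <->
  forall i j m, m \in msupp (A i j) -> (mdeg m)%:Z + b j = a i.
Proof.
by split=> h i j m /h => [->|<-]; rewrite ?subrK ?addrK.
Qed.

Lemma graded_hcomp_mx p q a b (A : 'M[S]_(p, q)) : graded a b (hcomp_mx a b A).
Proof. by move=> i j; rewrite mxE; exact: hom_deg_hcomp. Qed.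

Lemma hcomp_mx_id p q a b (A : 'M[S]_(p, q)) :
  graded a b A -> hcomp_mx a b A = A.
Proof. by move=> hA; apply/matrixP=> i j; rewrite mxE hcomp_id. Qed.

(** This allows a solution of a graded linear system to be replaced by its graded part. *)
Lemma hcomp_mxMr p q r a b c (A : 'M[S]_(p, q)) (B : 'M[S]_(q, r)) :
  graded b c B -> hcomp_mx a c (A *m B) = hcomp_mx a b A *m B.
Proof.
move=> hB; apply/matrixP=> i k; rewrite !mxE raddf_sum /=.
by apply: eq_bigr => j _; rewrite mxE -(hcompMr _ _ (hB j k)) addrA subrK.
Qed.

Lemma hcomp_mxMl p q r a b c (A : 'M[S]_(p, q)) (B : 'M[S]_(q, r)) :
  graded a b A -> hcomp_mx a c (A *m B) = A *m hcomp_mx b c B.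
Proof.
move=> hA; apply/matrixP=> i k; rewrite !mxE raddf_sum /=.
by apply: eq_bigr => j _; rewrite mxE -(hcompMl _ _ (hA i j)) addrA subrK.
Qed.

Lemma graded_mulmx p q r a b c (A : 'M[S]_(p, q)) (B : 'M[S]_(q, r)) :
  graded a b A -> graded b c B -> graded a c (A *m B).
Proof.
move=> hA hB; rewrite -(hcomp_mx_id hA) -(hcomp_mxMr _ _ hB).
exact: graded_hcomp_mx.
Qed.

Definition const_part p q (A : 'M[S]_(p, q)) : 'M[K]_(p, q) :=
  map_mx (mcoeff 0%MM) A.

Lemma const_partM p q r (A : 'M[S]_(p, q)) (B : 'M[S]_(q, r)) :
  const_part (A *m B) = const_part A *m const_part B.
Proof. exact: map_mxM. Qed.

Lemma const_part_eq0 p q (A : 'M[S]_(p, q)) :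
  const_part A = 0 <-> forall i j, (A i j)@_0%MM = 0.
Proof.
by split=> [/matrixP h i j|h]; [have:= h i j|apply/matrixP=> i j]; rewrite !mxE.
Qed.

End Homogeneous.

(** * Graded free resolutions and Betti numbers *)

Lemma projective_row (R : comNzRingType) k : projective ('rV[R]_k : lmodType R).
Proof.
move=> M N q h surj_q.
have [y yE] := fin_all_exists (fun i : 'I_k => surj_q (h (delta_mx 0 i))).
pose h' (v : 'rV[R]_k) := \sum_i v 0 i *: y i.
have lin_h' : linear h'.
  move=> a u v; rewrite scaler_sumr -big_split /=.
  by apply: eq_bigr => i _; rewrite !mxE scalerDl scalerA.
pose H := GRing.isLinear.Build R _ _ _ h' lin_h'.
pose h'L : {linear 'rV[R]_k -> M} := HB.pack h' H.
exists h'L => v; rewrite /= /h' linear_sum [v in RHS]row_sum_delta linear_sum.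
by apply: eq_bigr => i _; rewrite !linearZ yE.
Qed.

(** The row space is spanned by the basis vectors indexed by [A]; they are the rows of [E], which
    has its transpose as a right inverse. *)
Lemma rank_indicator_diag (L : fieldType) p (A : pred 'I_p) :
  \rank (diag_mx (\row_k (A k)%:R) : 'M[L]_p) = #|A|.
Proof.
set D := diag_mx _; pose E : 'M[L]_(#|A|, p) := \matrix_i delta_mx 0 (enum_val i).
have rowD k : row k D = (A k)%:R *: delta_mx 0 k.
  by rewrite row_diag_mx mxE.
have Efree : row_free E.
  apply/row_freeP; exists E^T; apply/matrixP=> i j; rewrite !mxE.
  rewrite (bigD1 (enum_val j)) //= big1 ?addr0 => [|k /negPf kj]; last first.
    by rewrite !mxE eqxx kj mulr0.
  by rewrite !mxE !eqxx mulr1 eq_sym (inj_eq enum_val_inj) eq_sym.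
move/eqP: (Efree) => <-; apply/eqP; rewrite eqn_leq; apply/andP; split; apply: mxrankS.
  apply/row_subP=> k; rewrite rowD; have [Ak|_] := boolP (A k); last first.
    by rewrite scale0r sub0mx.
  rewrite scale1r -(enum_rankK_in Ak Ak).
  by rewrite -(rowK (fun i => delta_mx 0 (enum_val i))) row_sub.
apply/row_subP=> i; rewrite rowK -[delta_mx _ _]scale1r.
have <- : (A (enum_val i))%:R = 1 :> L by rewrite [A _](enum_valP i).
by rewrite -rowD row_sub.
Qed.

Section FreeResolutions.
Variables (K : fieldType) (n : nat).
Local Notation S := {mpoly K[n]}.
Implicit Types (F G : graded_free_seq K n) (I : S -> Prop).

Definition free_mod F i : lmodType S := 'rV[S]_(frank F i).
Definition free_diff F i : {linear free_mod F i.+1 -> free_mod F i} :=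
  mulmxr (fdiff F i).

Definition free_aug_fun F (v : free_mod F 0) : S^o := (v *m faug F) 0 0.
Lemma free_aug_is_linear F : linear (@free_aug_fun F).
Proof.
by move=> a u v; rewrite /free_aug_fun mulmxDl -scalemxAl mxE [X in X + _]mxE.
Qed.
HB.instance Definition _ F :=
  GRing.isLinear.Build S (free_mod F 0) S^o _ (@free_aug_fun F)
    (@free_aug_is_linear F).
Definition free_aug F : {linear free_mod F 0 -> S^o} := @free_aug_fun F.

Lemma free_aug0 F (v : free_mod F 0) : free_aug F v = 0 <-> v *m faug F = 0.
Proof.
split=> [h|h]; last by rewrite /= /free_aug_fun h mxE.
by apply/matrixP=> i j; rewrite !ord1 [RHS]mxE.
Qed.

Lemma free_projective F i : projective (free_mod F i).
Proof. exact: projective_row. Qed.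

Section Resolution.
Variables (F : graded_free_seq K n) (I : S -> Prop).
Hypothesis resF : is_graded_free_resolution F I.

Lemma res_graded_diff i : graded (@fshift _ _ F i.+1) (@fshift _ _ F i) (fdiff F i).
Proof. by case: resF => [[gd _] _ _ _]; apply/gradedP=> k l m /gd. Qed.

Lemma res_graded_aug : graded (@fshift _ _ F 0) (fun _ => 0) (faug F).
Proof.
by case: resF => [[_ ga] _ _ _] k j m; rewrite ord1 subr0 => /ga.
Qed.

Lemma res_image g : I g <-> exists v, free_aug F v = g.
Proof. by case: resF => _ im _ _; exact: im. Qed.

Lemma res_exact0 (v : free_mod F 0) :
  free_aug F v = 0 <-> exists w, v = free_diff F 0 w.
Proof. by case: resF => _ _ e0 _; rewrite free_aug0. Qed.

Lemma res_exactS i (v : free_mod F i.+1) :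
  free_diff F i v = 0 <-> exists w, v = free_diff F i.+1 w.
Proof. by case: resF => _ _ _ ex; exact: ex. Qed.

Lemma res_aug_diff x : free_aug F (free_diff F 0 x) = 0.
Proof. by apply/res_exact0; exists x. Qed.

Lemma res_diff_diff i x : free_diff F i (free_diff F i.+1 x) = 0.
Proof. by apply/res_exactS; exists x. Qed.

Lemma tensor_diffM i : tensor_diff F i.+1 *m tensor_diff F i = 0.
Proof.
rewrite -const_partM; apply/const_part_eq0.
suff -> : fdiff F i.+1 *m fdiff F i = 0 by move=> k l; rewrite mxE mcoeff0.
apply/row_matrixP=> k; rewrite row0 rowE mulmxA.
exact: res_diff_diff (delta_mx 0 k).
Qed.

End Resolution.
#[global] Arguments res_graded_diff {F I} resF i _ _ _ _.
#[global] Arguments res_graded_aug {F I} resF _ _ _ _.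

(** A nonzero constant in a graded matrix joins generators of equal degree. *)
Lemma graded_const_component p q (a : 'I_p -> int) (b : 'I_q -> int) d
    (A : 'M[S]_(p, q)) : graded a b A ->
  diag_mx (\row_k (a k == d)%:R) *m const_part A =
  const_part A *m diag_mx (\row_k (b k == d)%:R).
Proof.
move=> gA; rewrite mul_diag_mx mul_mx_diag; apply/matrixP=> i j; rewrite !mxE.
have [<-|ab] := eqVneq (a i) (b j); first by rewrite mulrC.
by rewrite (hom_deg_const0 (gA i j)) ?subr_eq0 // mulr0 mul0r.
Qed.

Lemma tensor_componentM F i d :
  tensor_component F i d *m tensor_component F i d = tensor_component F i d.
Proof.
rewrite /tensor_component mulmx_diag; congr diag_mx; apply/rowP=> j.
by rewrite !mxE; case: (_ == _); rewrite ?mulr1 ?mulr0.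
Qed.

Lemma sub_tensor_component F i d p (A : 'M_(p, _)) :
  (A <= tensor_component F i d)%MS = (A *m tensor_component F i d == A).
Proof.
apply/idP/eqP=> [/submxP[w ->]|<-]; last exact: submxMl.
by rewrite -mulmxA tensor_componentM.
Qed.

(** The map from [Z] to [Z'/B'] induced by [Phi] has its kernel inside [B]; the bound is
    rank-nullity for [Phi *m C] on [Z] and for [C] on [Z']. *)
Lemma rank_homology_le (L : fieldType) p q r s (Z : 'M[L]_p) (B : 'M[L]_(r, p))
    (Z' : 'M[L]_q) (B' : 'M[L]_(s, q)) (Phi : 'M[L]_(p, q)) :
  (Z *m Phi <= Z')%MS -> (B' <= Z')%MS ->
  (forall k (A : 'M[L]_(k, p)),
     (A <= Z)%MS -> (A *m Phi <= B')%MS -> (A <= B)%MS) ->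
  (\rank Z - \rank B <= \rank Z' - \rank B')%N.
Proof.
move=> ZZ' BZ' inj; set C := cokermx B'.
have h1 := mxrank_mul_ker Z (Phi *m C); have h2 := mxrank_mul_ker Z' C.
have h3 : (\rank (Z :&: kermx (Phi *m C))%MS <= \rank B)%N.
  apply/mxrankS/inj; first exact: capmxSl.
  by rewrite submxE -mulmxA -sub_kermx capmxSr.
have h4 : (\rank (Z *m (Phi *m C)) <= \rank (Z' *m C))%N.
  by rewrite mulmxA mxrankS // submxMr.
have h5 : (\rank B' <= \rank (Z' :&: kermx C)%MS)%N.
  by rewrite mxrankS // sub_capmx BZ' sub_kermx mulmx_coker eqxx.
lia.
Qed.

(** * Independence of Betti numbers from the resolution *)

Section Independence.
Variables (F G : graded_free_seq K n) (I : S -> Prop).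
Hypothesis resF : is_graded_free_resolution F I.
Hypothesis resG : is_graded_free_resolution G I.

Lemma graded_chain_map : exists phi : forall i, 'M[S]_(frank F i, frank G i),
  [/\ forall i, graded (@fshift _ _ F i) (@fshift _ _ G i) (phi i),
      phi 0%N *m faug G = faug F &
      forall i, phi i.+1 *m fdiff G i = fdiff F i *m phi i].
Proof.
have im x : exists y, free_aug F x = free_aug G y.
  have /(res_image resG)[y <-] : I (free_aug F x) by apply/(res_image resF); exists x.
  by exists y.
have [phi [phi0 phiS]] := lift_chain_map (@free_projective F)
  (res_aug_diff resF) (res_diff_diff resF)
  (fun x => (res_exact0 resG x).1) (fun i x => (@res_exactS _ _ resG i x).1) im.
(* The lift need not respect degrees; its graded part satisfies the same identities because the
   differentials are graded. *)
exists (fun i => hcomp_mx (@fshift _ _ F i) (@fshift _ _ G i) (lin1_mx (phi i))).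
split=> [i||i]; first exact: graded_hcomp_mx.
- rewrite -(hcomp_mxMr _ _ (res_graded_aug resG)) -(hcomp_mx_id (res_graded_aug resF)).
  congr hcomp_mx; apply/row_matrixP=> k; rewrite !rowE mulmxA mul_rV_lin1.
  by apply/rowP=> j; rewrite ord1; exact: phi0.
- rewrite -(hcomp_mxMr _ _ (res_graded_diff resG i)).
  rewrite -(hcomp_mxMl _ _ (res_graded_diff resF i)).
  congr hcomp_mx; apply/row_matrixP=> k; rewrite !rowE !mulmxA !mul_rV_lin1.
  exact: phiS.
Qed.

End Independence.

(** The difference of [chi] and the identity is a chain map over zero. The lemma serves for round
    trips through another resolution. *)
Lemma endo_null_homotopy F I (chi : forall i, 'M[S]_(frank F i)) :
  is_graded_free_resolution F I ->
  chi 0%N *m faug F = faug F ->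
  (forall i, chi i.+1 *m fdiff F i = fdiff F i *m chi i) ->
  exists h : forall i, 'M[S]_(frank F i, frank F i.+1),
    chi 0%N = 1%:M + h 0%N *m fdiff F 0 /\
    forall i, chi i.+1 = 1%:M + fdiff F i *m h i + h i.+1 *m fdiff F i.+1.
Proof.
move=> resF chi0 chiS.
have [||h [h0 hS]] := @null_homotopy _ _ _ _ _ _ _ (@free_projective F)
  (res_diff_diff resF) (fun x => (res_exact0 resF x).1)
  (fun i x => (@res_exactS _ _ resF i x).1)
  (fun i => mulmxr (chi i - 1%:M) : {linear free_mod F i -> free_mod F i}).
- move=> x; apply/free_aug0.
  by rewrite /= -mulmxA mulmxBl chi0 mul1mx subrr mulmx0.
- move=> i x; rewrite /= -!mulmxA; congr (_ *m _).
  by rewrite mulmxBl mulmxBr chiS mul1mx mulmx1.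
exists (fun i => lin1_mx (h i)); split=> [|i].
- apply/row_matrixP=> k; rewrite !rowE mulmxDr mulmx1 mulmxA mul_rV_lin1.
  by have /= <- := h0 (delta_mx 0 k); rewrite mulmxBr mulmx1 addrC subrK.
- apply/row_matrixP=> k; rewrite !rowE !mulmxDr mulmx1 !mulmxA !mul_rV_lin1.
  have /= := hS i (delta_mx 0 k).
  by rewrite mulmxBr mulmx1 -addrA => <-; rewrite addrC subrK.
Qed.

Lemma tensor_boundaries_sub F I i d : is_graded_free_resolution F I ->
  (tensor_boundaries F i d <= tensor_cycles F i d)%MS.
Proof.
move=> resF; have gd := graded_const_component d (res_graded_diff resF i).
have bc : (tensor_boundaries F i d <= tensor_component F i d)%MS.
  by rewrite /tensor_boundaries {1}/tensor_component gd submxMl.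
case: i gd bc => //= i _ bc; rewrite sub_capmx bc sub_kermx.
by rewrite -mulmxA (tensor_diffM resF) mulmx0 eqxx.
Qed.

(** The round trip [phi i *m psi i] is homotopic to the identity, so [phi] stays injective on
    homology after tensoring with [K]. *)
Lemma dim_tensor_homology_le F G I i d :
  is_graded_free_resolution F I -> is_graded_free_resolution G I ->
  (dim_tensor_homology F i d <= dim_tensor_homology G i d)%N.
Proof.
move=> resF resG.
have [phi [gphi phi0 phiS]] := graded_chain_map resF resG.
have [psi [gpsi psi0 psiS]] := graded_chain_map resG resF.
have [||h [h0 hS]] :=
  @endo_null_homotopy F I (fun j => phi j *m psi j) resF.
- by rewrite -mulmxA psi0.
- by move=> j; rewrite -mulmxA psiS mulmxA phiS -mulmxA.
have hphi : tensor_component F i d *m const_part (phi i) =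
    const_part (phi i) *m tensor_component G i d.
  exact: graded_const_component.
have sub_comp p (A : 'M_(p, _)) :
    (A <= tensor_cycles F i d)%MS -> (A <= tensor_component F i d)%MS.
  by case: (i) A => [|j] A //; rewrite sub_capmx => /andP[].
have Zcomp p (A : 'M_(p, _)) : (A <= tensor_component F i d)%MS ->
    (A *m const_part (phi i) <= tensor_component G i d)%MS.
  by rewrite sub_tensor_component => /eqP <-; rewrite -mulmxA hphi mulmxA submxMl.
apply: (rank_homology_le (Phi := const_part (phi i))).
- case: i hphi sub_comp Zcomp => [|i] _ sub_comp Zcomp; first exact: Zcomp.
  rewrite sub_capmx Zcomp ?sub_comp //= sub_kermx -mulmxA.
  rewrite -[tensor_diff G i]/(const_part _) -const_partM phiS const_partM mulmxA.
  have /eqP -> : (tensor_cycles F i.+1 d *m const_part (fdiff F i) == 0).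
    by rewrite -sub_kermx capmxSr.
  by rewrite mul0mx.
- exact: tensor_boundaries_sub resG.
move=> p A AZ /submxP[w Aw].
(* A boundary of any degree suffices, since projection to degree [d] fixes [A] and commutes with the
   differential. *)
suff [u Au] : exists u, A = u *m tensor_diff F i.
  have := sub_comp _ _ AZ; rewrite sub_tensor_component Au => /eqP <-.
  rewrite -mulmxA -(graded_const_component d (res_graded_diff resF i)).
  exact: submxMl.
have AE : A *m const_part (phi i *m psi i) =
    w *m tensor_component G i.+1 d *m const_part (psi i.+1) *m tensor_diff F i.
  by rewrite const_partM mulmxA Aw -!mulmxA -!const_partM psiS.
suff [u Au] : exists u, A *m const_part (phi i *m psi i) = A + u *m tensor_diff F i.
  exists (w *m tensor_component G i.+1 d *m const_part (psi i.+1) - u).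
  by rewrite mulmxBl -AE Au addrK.
have cp1 m : const_part (1%:M : 'M[S]_m) = 1%:M by exact: map_mx1.
have cpD p1 p2 (X Y : 'M[S]_(p1, p2)) :
  const_part (X + Y) = const_part X + const_part Y by exact: map_mxD.
case: i {hphi sub_comp Zcomp AE w Aw} A AZ => [|i] A AZ.
  exists (A *m const_part (h 0%N)).
  by rewrite h0 cpD cp1 mulmxDr mulmx1 const_partM mulmxA.
exists (A *m const_part (h i.+1)).
rewrite hS !cpD cp1 !mulmxDr mulmx1 !const_partM !mulmxA.
(* The homotopy term that starts with the differential vanishes on cycles. *)
have /eqP -> : (A *m const_part (fdiff F i) == 0).
  by move: AZ; rewrite sub_capmx sub_kermx => /andP[].
by rewrite mul0mx addr0.
Qed.

(** The existence of [F] makes the choice by [epsilon] a genuine resolution; the inequality is then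
    used in both directions. *)
Lemma betti_resolution F I i d : is_graded_free_resolution F I ->
  betti I i d = dim_tensor_homology F i d.
Proof.
move=> resF; have resC : is_graded_free_resolution (chosen_resolution I) I.
  exact: (epsilon_spec _ (fun F' => is_graded_free_resolution F' I)
    (ex_intro _ F resF)).
apply/eqP; rewrite eqn_leq; apply/andP; split.
  exact: dim_tensor_homology_le resC resF.
exact: dim_tensor_homology_le resF resC.
Qed.

Definition minimal_diff F := forall i, tensor_diff F i = 0.

Lemma betti_minimal F I i d :
  is_graded_free_resolution F I -> minimal_diff F ->
  betti I i d = #|[set k : 'I_(frank F i) | fshift k == d]|.
Proof.
move=> resF minF; rewrite (betti_resolution _ _ resF) /dim_tensor_homology.
rewrite /tensor_boundaries minF mulmx0 mxrank0 subn0.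
have -> : \rank (tensor_cycles F i d) = \rank (tensor_component F i d).
  case: i => [|i] //=; rewrite minF; apply/eqP.
  rewrite eqn_leq !mxrankS ?capmxSl // sub_capmx submx_refl.
  by rewrite sub_kermx mulmx0 eqxx.
by rewrite rank_indicator_diag cardsE.
Qed.

(** If [d < N], the round trip through the projective resolution is 0 in degree [N], yet homotopic
    to the identity. Modulo the variables minimality kills the homotopy terms, so that 1 = 0 on a
    nonzero space. *)
Lemma projective_resolution_length F I N d :
  is_graded_free_resolution F I -> minimal_diff F -> (0 < frank F N)%N ->
  has_projective_resolution I d -> (N <= d)%N.
Proof.
move=> resF minF FN [P [D [e [[projP Pd] im ex0 exS]]]].
rewrite leqNgt; apply/negP=> dN.
have imF x : exists y, free_aug F x = e y.
  have /im[y <-] : I (free_aug F x) by apply/(res_image resF); exists x.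
  by exists y.
have imP x : exists y, e x = free_aug F y.
  have /(res_image resF)[y <-] : I (e x) by apply/im; exists x.
  by exists y.
have [phi [phi0 phiS]] := lift_chain_map (@free_projective F)
  (res_aug_diff resF) (res_diff_diff resF) (fun x => (ex0 x).1)
  (fun i x => (exS i x).1) imF.
have eD x : e (D 0%N x) = 0 by apply/ex0; exists x.
have DD i x : D i (D i.+1 x) = 0 by apply/exS; exists x.
have [psi [psi0 psiS]] := lift_chain_map projP eD DD
  (fun x => (res_exact0 resF x).1) (fun i x => (@res_exactS _ _ resF i x).1) imP.
have [||h [_ hS]] := @endo_null_homotopy F I
    (fun i => lin1_mx (psi i \o phi i : {linear _ -> _})) resF.
- apply/row_matrixP=> k; rewrite !rowE mulmxA mul_rV_lin1 /=.
  apply/rowP=> j; rewrite ord1 -[LHS]/(free_aug F (psi 0%N (phi 0%N (delta_mx 0 k)))).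
  by rewrite psi0 phi0.
- move=> i; apply/row_matrixP=> k; rewrite !rowE !mulmxA !mul_rV_lin1 /=.
  by rewrite -phiS -psiS.
(* [d < N] excludes [N = 0], so the homotopy formula for successor degrees applies. *)
case: N FN dN => // N FN dN; have := congr1 (@const_part K n _ _) (hS N).
have -> : lin1_mx (psi N.+1 \o phi N.+1) = 0.
  apply/row_matrixP=> k; rewrite rowE row0.
  by rewrite (mul_rV_lin1 (psi N.+1 \o phi N.+1 : {linear _ -> _})) /=
    (Pd _ dN (phi _ _)) linear0.
rewrite /const_part !map_mxD !map_mxM.
rewrite -![map_mx _ (fdiff _ _)]/(tensor_diff _ _) !minF.
rewrite mul0mx mulmx0 !addr0 map_mx0 map_mx1.
move/matrixP/(_ (Ordinal FN) (Ordinal FN))/eqP; rewrite !mxE eqxx.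
by rewrite eq_sym oner_eq0.
Qed.

Lemma free_projective_resolution F I d :
  is_graded_free_resolution F I -> (forall i, (d < i)%N -> frank F i = 0%N) ->
  has_projective_resolution I d.
Proof.
move=> resF Fd; exists (free_mod F), (free_diff F), (free_aug F); split.
- split=> [i|i /Fd Fi x]; first exact: free_projective.
  by apply/rowP=> -[j jF]; exfalso; rewrite Fi in jF.
- exact: res_image resF.
- exact: res_exact0 resF.
- exact: res_exactS resF.
Qed.

End FreeResolutions.

(** * Mapping cones *)

Lemma lift_rows (R : comNzRingType) p q k (A : 'M[R]_(p, q)) (X : 'M[R]_(k, q)) :
  (forall i, exists w, row i X = w *m A) -> exists W, X = W *m A.
Proof.
move=> /fin_all_exists[w wE]; exists (\matrix_i w i).
by apply/row_matrixP=> i; rewrite row_mul rowK.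
Qed.

Section Cone.
Variables (K : fieldType) (n : nat).
Local Notation S := {mpoly K[n]}.
Implicit Types (F G : graded_free_seq K n) (I J L : S -> Prop).

(* If [G] resolves [L], then [qrank], [qshift] and [qdiff] describe the
   resolution of S/L, which is [G] shifted by one place with S at the end. *)
Definition qrank G i : nat := if i is i'.+1 then frank G i' else 1.

Definition qshift G i : 'I_(qrank G i) -> int :=
  match i return 'I_(qrank G i) -> int with
  | 0 => fun _ => 0
  | i'.+1 => @fshift _ _ G i'
  end.

Definition qdiff G i : 'M[S]_(qrank G i.+1, qrank G i) :=
  match i return 'M[S]_(qrank G i.+1, qrank G i) with
  | 0 => faug G
  | i'.+1 => fdiff G i'
  end.

Lemma graded_qdiff G L i : is_graded_free_resolution G L ->
  graded (@qshift G i.+1) (@qshift G i) (qdiff G i).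
Proof.
case: i => [|i] resG; first exact: res_graded_aug resG.
exact: res_graded_diff resG i.
Qed.

#[global] Arguments graded_qdiff {G L i} resG _ _ _ _.

Lemma qdiff_exact G L i (v : 'rV_(qrank G i.+1)) :
  is_graded_free_resolution G L ->
  v *m qdiff G i = 0 <-> exists w, v = w *m qdiff G i.+1.
Proof. by case: i v => [|i] v [_ _ e0 eS]; [exact: e0|exact: eS]. Qed.

Lemma qdiffM G L i :
  is_graded_free_resolution G L -> qdiff G i.+1 *m qdiff G i = 0.
Proof.
move=> resG; apply/row_matrixP=> k; rewrite row0 rowE mulmxA.
by apply/(qdiff_exact _ resG); exists (delta_mx 0 k).
Qed.

Lemma fdiffM F I i :
  is_graded_free_resolution F I -> fdiff F i.+1 *m fdiff F i = 0.
Proof. exact: (@qdiffM F I i.+1). Qed.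

Lemma fdiff_aug F I : is_graded_free_resolution F I -> fdiff F 0 *m faug F = 0.
Proof. exact: (@qdiffM F I 0). Qed.

Lemma aug_mem F I (v : 'rV_(frank F 0)) :
  is_graded_free_resolution F I -> I ((v *m faug F) 0 0).
Proof. by case=> _ im _ _; apply/im; exists v. Qed.

Lemma scalar_mx11 (A : 'M[S]_1) (f : S) : (A *m f%:M) 0 0 = A 0 0 * f.
Proof. by rewrite mul_mx_scalar mxE mulrC. Qed.

Section Construction.
Variables (F G : graded_free_seq K n) (J L : S -> Prop) (f : S) (d : int).
Hypothesis resF : is_graded_free_resolution F J.
Hypothesis resG : is_graded_free_resolution G L.
Hypothesis idJ : is_ideal J.
Hypothesis LE : forall g, L g <-> J (g * f).
Hypothesis hf : hom_deg d f.

(** The twist by [d] turns multiplication by [f] into a map of degree 0. *)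
Definition gshift i (k : 'I_(qrank G i)) : int := qshift k + d.

Lemma graded_gshift i : graded (@gshift i.+1) (@gshift i) (qdiff G i).
Proof.
move=> k l; apply: hom_deg_ext (graded_qdiff resG k l) _.
by rewrite /gshift opprD addrACA subrr addr0.
Qed.

#[global] Arguments graded_gshift : clear implicits.

(* A chain map, up to alternating signs, from the resolution of S/L to that of
   S/J, lifting the multiplication by [f]. *)
Definition comparison (theta : forall i, 'M[S]_(qrank G i.+1, frank F i)) :=
  [/\ forall i, graded (@gshift i.+1) (@fshift _ _ F i) (theta i),
      theta 0%N *m faug F = - (faug G *m f%:M) &
      forall i, theta i.+1 *m fdiff F i = - (qdiff G i.+1 *m theta i)].

Lemma comparison_exists : exists theta, comparison theta.
Proof.
pose T i := 'M[S]_(qrank G i.+1, frank F i).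
pose Inv i (u : T i) : Prop :=
  [/\ graded (@gshift i.+1) (@fshift _ _ F i) u,
    exists W, - (qdiff G i.+1 *m u) = W *m fdiff F i &
    match i return T i -> Prop with
    | 0 => fun u => u *m faug F = - (faug G *m f%:M)
    | _ => fun _ => True
    end u].
pose Rel i (u : T i) (v : T i.+1) := v *m fdiff F i = - (qdiff G i.+1 *m u).
have [||theta [Itheta Rtheta]] := @dependent_choice_nat T Inv Rel.
(* The rows lift because [f] multiplies the generators of [L] into [J]. *)
- have [k|W WE] := @lift_rows _ _ _ _ (faug F) (- (faug G *m f%:M)).
    have : J ((row k (- (faug G *m f%:M))) 0 0).
      rewrite linearN mxE -mulN1r /=; case: idJ => _ _; apply.
      rewrite row_mul scalar_mx11; apply/LE; rewrite rowE.
      exact: aug_mem resG.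
    case: resF => _ im _ _ /im[v vE]; exists v; apply/rowP=> j.
    by rewrite !ord1 vE.
  set h := hcomp_mx (@gshift 1) (@fshift _ _ F 0) W.
  have hE : h *m faug F = - (faug G *m f%:M).
    rewrite -(hcomp_mxMr _ _ (res_graded_aug resF)) -WE hcomp_mx_id //.
    move=> k j; rewrite mxE mul_mx_scalar mxE mulrC; apply: hom_degN.
    apply: hom_deg_ext (hom_degM (graded_qdiff resG k j) hf) _.
    by rewrite ord1 /gshift /= !subr0.
  exists h; split=> //; first exact: graded_hcomp_mx.
  apply: lift_rows => k; case: resF => _ _ e0 _; apply/e0.
  rewrite rowE -mulmxA mulNmx -mulmxA hE !mulmxN opprK.
  have q0 : qdiff G 1 *m faug G = 0 := @qdiffM G L 0 resG.
  by rewrite (mulmxA (qdiff G 1)) q0 mul0mx mulmx0.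
- move=> i u [gu [W WE] _].
  set h := hcomp_mx (@gshift i.+2) (@fshift _ _ F i.+1) W.
  have hE : h *m fdiff F i = - (qdiff G i.+1 *m u).
    rewrite -(hcomp_mxMr _ _ (res_graded_diff resF i)) -WE hcomp_mx_id //.
    move=> k j; rewrite mxE; apply: hom_degN.
    exact: graded_mulmx (@graded_gshift i.+1) gu _ _.
  exists h; split=> //; split=> //; first exact: graded_hcomp_mx.
  apply: lift_rows => k; case: resF => _ _ _ eS; apply/eS.
  rewrite rowE -mulmxA mulNmx -mulmxA hE !mulmxN opprK.
  by rewrite (mulmxA (qdiff G i.+2)) (@qdiffM G L i.+1 resG) mul0mx mulmx0.
by exists theta; split=> // [i|]; [case: (Itheta i)|case: (Itheta 0%N)].
Qed.

Variable theta : forall i, 'M[S]_(qrank G i.+1, frank F i).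
Hypothesis thetaP : comparison theta.

(** The two summands carry the same index because [F] resolves the ideal [J], and so sits one place
    lower than in a resolution of S/J. The signs are in [theta]. *)
Definition cone : graded_free_seq K n := @GradedFreeSeq K n
  (fun i => frank F i + qrank G i)%N
  (fun i k => match split k with inl a => fshift a | inr b => gshift b end)
  (fun i => block_mx (fdiff F i) 0 (theta i) (qdiff G i))
  (col_mx (faug F) f%:M).

Lemma cone_resolution :
  is_graded_free_resolution cone (fun g => exists a s, J a /\ g = a + s * f).
Proof.
case: (thetaP) => gth th0 thS; split.
- split=> [i|k].
    apply/(@gradedP K n _ _ (@fshift _ _ cone i.+1) (@fshift _ _ cone i)).
    move=> k l /=; rewrite mxE; case: splitP => k' _; rewrite mxE;
      case: splitP => l' _.
    + exact: res_graded_diff resF i k' l'.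
    + by rewrite mxE; exact: hom_deg0.
    + exact: gth.
    + exact: graded_gshift.
  move=> m /=; rewrite mxE; case: splitP => k' _.
    by move/(res_graded_aug resF) ->; rewrite subr0.
  by rewrite mxE ord1 eqxx => /hf ->; rewrite /gshift /= add0r.
- move=> g; split=> [[a [s [Ja ->]]]|[v <-]].
    case: (resF) => _ im _ _; have [v <-] := (im a).1 Ja.
    exists (row_mx v s%:M); rewrite mul_row_col mxE; congr (_ + _).
    by rewrite scalar_mx11 mxE eqxx mulr1n.
  rewrite -[v]hsubmxK mul_row_col mxE; eexists; eexists; split; last first.
    by congr (_ + _); exact: scalar_mx11.
  exact: aug_mem resF.
- move=> v; rewrite -[v]hsubmxK; set a := lsubmx v; set b := rsubmx v.
  rewrite mul_row_col; split=> [abE|[w]].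
    (* If [(a, b)] maps to 0, then [b * f] lies in [J], so [b] lies in [L] and comes from some [w];
       subtracting [w *m theta 0] from [a] leaves a cycle of [F]. *)
    have Lb : L (b 0 0).
      apply/LE; have /matrixP/(_ 0 0) := abE.
      rewrite mxE scalar_mx11 [RHS]mxE => /eqP.
      rewrite addrC addr_eq0 => /eqP ->; rewrite -mulN1r.
      by case: idJ => _ _; apply; exact: aug_mem resF.
    case: (resG) => _ imG _ _; have [w wE] := (imG _).1 Lb.
    have bE : b = w *m faug G by apply/rowP=> j; rewrite !ord1 wE.
    have : (a - w *m theta 0%N) *m faug F = 0.
      by rewrite mulmxBl -mulmxA th0 mulmxN opprK mulmxA -bE.
    case: (resF) => _ _ e0 _ /e0[u uE].
    exists (row_mx u w); rewrite mul_row_block /= mulmx0 add0r -bE -uE.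
    by rewrite subrK.
  rewrite -[w]hsubmxK mul_row_block mulmx0 add0r => /eq_row_mx[-> ->].
  rewrite mulmxDl -!mulmxA (fdiff_aug resF) mulmx0 add0r th0 mulmxN.
  by rewrite addNr.
- move=> i v; rewrite -[v]hsubmxK; set a := lsubmx v; set b := rsubmx v.
  rewrite mul_row_block mulmx0 add0r; split=> [|[w]].
    rewrite -(row_mx0 _ 1 _ _) => /eq_row_mx[aE /(qdiff_exact _ resG)[w bE]].
    have : (a - w *m theta i.+1) *m fdiff F i = 0.
      by rewrite mulmxBl -mulmxA thS mulmxN opprK mulmxA -bE.
    case: (resF) => _ _ _ eS /eS[u uE].
    exists (row_mx u w); rewrite mul_row_block mulmx0 add0r -bE -uE.
    by rewrite subrK.
  rewrite -[w]hsubmxK mul_row_block mulmx0 add0r => /eq_row_mx[-> ->].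
  rewrite mulmxDl -!mulmxA (fdiffM _ resF) mulmx0 add0r thS mulmxN addNr.
  by rewrite (qdiffM _ resG) mulmx0 row_mx0.
Qed.

(* The generators of [F_i] of degree [i + j] form the linear strand of degree [j]
   of [F]. *)
Definition strand_injective F := forall i (j : int) (c : 'rV[K]_(frank F i.+1)),
  (forall k, fshift k != i.+1%:Z + j -> c 0 k = 0) ->
  (forall l, fshift l = i%:Z + j ->
     (map_mx (@mpolyC n K) c *m fdiff F i) 0 l = 0) ->
  c = 0.

(** The shape of the Koszul resolution on [r] independent linear forms, with indices moved by one
    because [L] is resolved rather than S/L. *)
Definition linear_resolution G L r :=
  [/\ is_graded_free_resolution G L,
      forall i (k : 'I_(frank G i)), fshift k = i.+1%:Z &
      forall i, frank G i = 'C(r, i.+1)].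

Variable r : nat.
Hypothesis linG : linear_resolution G L r.

Lemma linear_qshift i (k : 'I_(qrank G i)) : qshift k = i%:Z.
Proof. by case: linG => _ h _; case: i k => //= i k; rewrite h. Qed.

Lemma linear_qrank i : qrank G i = 'C(r, i).
Proof. by case: linG => _ _ h; case: i => [|i] /=; rewrite ?bin0 ?h. Qed.

Lemma linear_qdiff_const i : const_part (qdiff G i) = 0.
Proof.
apply/const_part_eq0=> k l.
by apply: hom_deg_const0 (graded_qdiff resG k l) _; rewrite !linear_qshift; lia.
Qed.

(** A constant cycle is a boundary, and boundaries have no constant part. *)
Lemma linear_qdiff_inj i (c : 'rV[K]_(qrank G i.+1)) :
  map_mx (@mpolyC n K) c *m qdiff G i = 0 -> c = 0.
Proof.
move/(qdiff_exact _ resG) => [w cE].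
have <- : const_part (map_mx (@mpolyC n K) c) = c.
  by apply/matrixP=> k l; rewrite !mxE mpolyCK.
by rewrite cE const_partM linear_qdiff_const mulmx0.
Qed.

(** By induction on the homological degree: the constants in a row of [theta i.+1] form a vector in
    the strand of degree [d + 1], and the comparison identity shows that the differential kills it
    within that strand. *)
Lemma theta_const_part : strand_injective F -> minimal_diff F ->
  const_part (theta 0%N) = 0 -> forall i, const_part (theta i) = 0.
Proof.
case: thetaP => gth _ thS injF minF th0; elim=> // i IHi.
apply/row_matrixP=> s; rewrite row0; apply: (injF i (d + 1)) => [k kE|l lE].
  rewrite 2!mxE; apply: hom_deg_const0 (gth i.+1 s k) _.
  by move: kE; rewrite /gshift linear_qshift; apply: contraNneq; lia.
(* For [l] in this strand the entries [theta i k l] have degree 0, so they are constants and vanish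
   by induction. *)
have : (theta i.+1 *m fdiff F i) s l = 0.
  rewrite thS 2!mxE big1 ?oppr0 // => k _.
  have hk : hom_deg 0 (theta i k l).
    by apply: hom_deg_ext (gth i k l) _; rewrite lE /gshift linear_qshift; lia.
  have := (const_part_eq0 _).1 IHi k l.
  by rewrite (hom_deg0_const hk) mpolyCK => ->; rewrite mpolyC0 mulr0.
(* The degrees [a] and [b] of the two factors add up to 1. Unless [a = 0], where the entry of
   [theta] is its constant, both terms vanish: some factor has negative degree, or [b = 0] and
   minimality applies, or [b < 0]. *)
rewrite !mxE => {2}<-; apply: eq_bigr => k _; rewrite !mxE.
have hth := gth i.+1 s k; have hF := res_graded_diff resF i k l.
move: hth hF; rewrite lE /gshift linear_qshift.
set a := (X in hom_deg X (theta _ _ _)) => hth.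
set b := (X in hom_deg X _) => hF.
have ab : a + b = 1 by rewrite /a /b; lia.
have [a0|a0] := eqVneq a 0; first by rewrite a0 in hth; rewrite {2}(hom_deg0_const hth).
rewrite (hom_deg_const0 hth) // mpolyC0 mul0r.
have [al0|a_ge0] := ltP a 0; first by rewrite (hom_deg_neg hth al0) mul0r.
have [b0|b0] := eqVneq b 0; last first.
  by rewrite (hom_deg_neg hF) ?mulr0 //; lia.
rewrite b0 in hF; have := (const_part_eq0 _).1 (minF i) k l.
by rewrite (hom_deg0_const hF) mpolyCK => ->; rewrite mpolyC0 mulr0.
Qed.

Lemma cone_minimal : strand_injective F -> minimal_diff F ->
  const_part (theta 0%N) = 0 -> minimal_diff cone.
Proof.
move=> injF minF th0 i; rewrite /tensor_diff /= map_block_mx.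
rewrite -![map_mx _ (fdiff _ _)]/(tensor_diff _ _) minF map_mx0.
rewrite -!/(const_part _) theta_const_part // linear_qdiff_const.
by rewrite block_mx0.
Qed.

Lemma cone_shiftl i (k : 'I_(frank F i)) :
  @fshift _ _ cone i (lshift _ k) = fshift k.
Proof. by rewrite /= (unsplitK (inl _ k)). Qed.

Lemma cone_shiftr i (k : 'I_(qrank G i)) :
  @fshift _ _ cone i (rshift _ k) = i%:Z + d.
Proof. by rewrite /= (unsplitK (inr _ k)) /gshift linear_qshift. Qed.

Lemma cone_strand_injective : strand_injective F -> strand_injective cone.
Proof.
move=> injF i j c; rewrite -[c]hsubmxK; set a := lsubmx c; set b := rsubmx c.
move=> c0; rewrite /= map_row_mx mul_row_block mulmx0 add0r => ker.
have b0 : b = 0.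
  (* The new summand lies in the strand of degree [d]: there its differential is injective on
     constants, and in any other strand [b] is 0 by degree. *)
  have [jd|jd] := eqVneq j d.
    apply: linear_qdiff_inj; apply/rowP=> l; rewrite [RHS]mxE.
    rewrite -(ker (rshift _ l)) ?row_mxEr //.
    by apply: etrans (cone_shiftr l) _; rewrite jd.
  apply/rowP=> k; rewrite [RHS]mxE -(c0 (rshift _ k)) ?row_mxEr //.
  by rewrite (cone_shiftr k); apply: contraNneq jd; lia.
rewrite b0; suff -> : a = 0 by rewrite row_mx0.
apply: (injF i j) => [k kj|l lj].
  by rewrite -(c0 (lshift _ k)) ?row_mxEl // (cone_shiftl k).
rewrite -(ker (lshift _ l)); last exact: etrans (cone_shiftl l) lj.
by rewrite row_mxEl b0 map_mx0 mul0mx addr0.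
Qed.

Lemma cone_count i (z : int) :
  #|[set k | @fshift _ _ cone i k == i%:Z + z]| =
  (#|[set k : 'I_(frank F i) | fshift k == (i%:Z + z)%R]|
   + (if d == z then 'C(r, i) else 0))%N.
Proof.
rewrite -!sum1dep_card big_split_ord; congr (_ + _)%N.
  by apply: eq_bigl => k; rewrite cone_shiftl.
under eq_bigl => k do rewrite cone_shiftr (inj_eq (addrI _)).
case: ifP => _; last by rewrite big_pred0_eq.
by rewrite sum1_card card_ord linear_qrank.
Qed.

End Construction.
End Cone.

(** * Ideals spanned by initial segments and resolutions built along them *)

Section Span.
Variables (K : fieldType) (n m : nat) (f : 'I_m -> {mpoly K[n]}).

Lemma ideal_span_ideal (P : pred 'I_m) : is_ideal (ideal_span P f).
Proof.
split; first by exists (fun _ => 0); rewrite big1 // => t _; rewrite mul0r.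
- move=> _ _ [c ->] [e ->]; exists (fun t => c t + e t).
  by rewrite -big_split /=; apply: eq_bigr => t _; rewrite mulrDl.
- move=> s _ [c ->]; exists (fun t => s * c t).
  by rewrite mulr_sumr; apply: eq_bigr => t _; rewrite mulrA.
Qed.

Lemma mem_ideal_span (P : pred 'I_m) t : P t -> ideal_span P f (f t).
Proof.
move=> Pt; exists (fun u => (u == t)%:R); rewrite (bigD1 t) //= eqxx mul1r.
by rewrite big1 ?addr0 // => u /andP[_ /negPf ->]; rewrite mul0r.
Qed.

Lemma ideal_sum (I : {mpoly K[n]} -> Prop) (T : finType) (P : pred T) F :
  is_ideal I -> (forall t, P t -> I (F t)) -> I (\sum_(t | P t) F t).
Proof. by move=> [I0 ID _] IF; apply: big_ind. Qed.

Lemma ideal_span_sub (P : pred 'I_m) (I : {mpoly K[n]} -> Prop) :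
  is_ideal I -> (forall t, P t -> I (f t)) -> forall g, ideal_span P f g -> I g.
Proof.
move=> idI If _ [c ->]; apply: ideal_sum => // t Pt.
by case: idI => _ _; apply; exact: If.
Qed.

Lemma ideal_span_ltS (p : 'I_m) g :
  ideal_span (fun q : 'I_m => (q < p.+1)%N) f g <->
  exists a s, ideal_span (fun q : 'I_m => (q < p)%N) f a /\ g = a + s * f p.
Proof.
split=> [|[a [s [Ja ->]]]].
  case=> c ->; exists (\sum_(q < m | (q < p)%N) c q * f q), (c p).
  split; first by exists c.
  rewrite (bigD1 p) //= addrC; congr (_ + _); apply: eq_bigl => q.
  by rewrite ltnS ltn_neqAle andbC.
have [_ JD JM] := ideal_span_ideal (fun q : 'I_m => (q < p.+1)%N).
apply: JD; last by apply/JM/mem_ideal_span.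
move: Ja; apply: ideal_span_sub; first exact: ideal_span_ideal.
by move=> t tp; apply: mem_ideal_span; rewrite /= ltnW.
Qed.

Definition nonredundant :=
  forall p, ~ ideal_span (fun q => q != p) f (f p).

Variable N : 'I_m -> nat.

(** The invariant of the induction along the generators. The map [t] identifies the basis of F_0
    with distinct generators, so that a constant in the next comparison map becomes a redundancy;
    the last clause is the Betti formula for the ideal reached so far. *)
Definition good_resolution (p : nat) (F : graded_free_seq K n) :=
  [/\ is_graded_free_resolution F (ideal_span (fun q : 'I_m => (q < p)%N) f),
      minimal_diff F,
      strand_injective F,
      exists t : 'I_(frank F 0) -> 'I_m,
        injective t /\ forall k, (t k < p)%N /\ faug F k 0 = f (t k) &
      forall i (z : int), #|[set k : 'I_(frank F i) | fshift k == i%:Z + z]| =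
        (\sum_(q < m | (q < p)%N && ((deg (f q))%:Z == z)) 'C(N q, i))%N].

Lemma resolution_ext F (I I' : {mpoly K[n]} -> Prop) :
  (forall g, I g <-> I' g) ->
  is_graded_free_resolution F I -> is_graded_free_resolution F I'.
Proof.
by move=> II' [gr im e0 eS]; split=> // g; rewrite -II'.
Qed.

Lemma good_resolution0 : good_resolution 0 (zero_free_seq K n).
Proof.
split.
- split=> [|g|v|i v] /=.
  + by split=> [i [] | []].
  + split=> [[c ->]|[v <-]].
      by exists 0; rewrite mul0mx mxE big_pred0.
    by exists (fun _ => 0); rewrite mulmx0 mxE big_pred0.
  + by split=> _; [exists 0; apply/rowP=> -[] | rewrite mulmx0].
  + by split=> _; [exists 0; apply/rowP=> -[] | rewrite mulmx0].
- by move=> i; apply/matrixP=> -[].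
- by move=> i j c _ _; apply/rowP=> -[].
- by exists (fun k : 'I_0 => False_rect _ (notF (ltn_ord k))); split=> [] [].
- move=> i z; rewrite big_pred0 //.
  by apply/eqP; rewrite cards_eq0; apply/eqP/setP=> -[].
Qed.

(** With a nonzero constant at [(s, k)], row [s] of the comparison identity could be solved for
    [f (t k)] in terms of [f p] and the other [f (t l)]. *)
Lemma comparison0_const (p : 'I_m) (F G : graded_free_seq K n)
    (theta : forall i, 'M_(qrank G i.+1, frank F i)) :
  nonredundant -> good_resolution p F ->
  comparison (f p) (deg (f p))%:Z theta ->
  const_part (theta 0%N) = 0.
Proof.
move=> nred [_ _ _ [t [t_inj tP]] _] [gth th0 _].
apply/const_part_eq0=> s k; apply/eqP/negP=> /negP a0.
(* A nonzero constant coefficient forces degree 0, so the entry is that constant. *)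
have hth : theta 0%N s k = ((theta 0%N s k)@_0%MM)%:MP.
  have := gth 0%N s k; set z := _ - _ => hz; have [z0|z0] := eqVneq z 0.
    by apply: hom_deg0_const; rewrite -z0.
  by rewrite (hom_deg_const0 hz z0) eqxx in a0.
have idN := ideal_span_ideal (fun q => q != t k); have [_ ND NM] := idN.
apply: (nred (t k)).
suff : ideal_span (fun q => q != t k) f (theta 0%N s k * f (t k)).
  move/(NM (((theta 0%N s k)@_0%MM)^-1)%:MP).
  by rewrite hth mulrA -mpolyCM mpolyCK mulVf // mul1r.
have := congr1 (fun A : 'cV_ _ => A s 0) th0.
rewrite mxE (bigD1 k) //= (tP k).2 => /eqP; rewrite eq_sym -subr_eq eq_sym.
move=> /eqP ->; rewrite mxE mul_mx_scalar mxE [f p * _]mulrC -mulNr.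
rewrite -[- \sum_(_ | _) _]mulN1r; apply: ND; apply/NM.
  by apply: mem_ideal_span; rewrite /= -val_eqE neq_ltn (tP k).1 orbT.
apply: ideal_sum => // l lk; apply/NM; rewrite (tP l).2; apply: mem_ideal_span.
by rewrite /= (inj_eq t_inj).
Qed.

Lemma good_resolution_step (p : 'I_m) F G :
  nonredundant -> f p \is homog mdeg -> good_resolution p F ->
  linear_resolution G (prev_colon f p) (N p) ->
  exists F', good_resolution p.+1 F'.
Proof.
move=> nred hp goodF linG; have [resF minF injF [t [t_inj tP]] cntF] := goodF.
have [resG _ _] := linG; have hf := homog_hom_deg hp.
have idJ := ideal_span_ideal (fun q : 'I_m => (q < p)%N).
have [theta thP] := comparison_exists resF resG idJ (fun=> conj id id) hf.
have th0 := comparison0_const nred goodF thP.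
exists (cone (f p) (deg (f p))%:Z theta); split.
- apply: resolution_ext (cone_resolution resF resG idJ (fun=> conj id id) hf thP).
  by move=> g; symmetry; exact: ideal_span_ltS.
- exact: (cone_minimal resF resG thP linG).
- exact: (cone_strand_injective resG linG injF).
(* The new basis element goes to [f p]; injectivity persists because earlier indices are below
   [p]. *)
- exists (fun k => match split k with inl k' => t k' | inr _ => p end); split.
    move=> k l; case: (splitP k) => k' kE; case: (splitP l) => l' lE.
    + by move/t_inj=> k'l'; apply: val_inj; rewrite /= kE lE k'l'.
    + by move=> tk; have [] := tP k'; rewrite tk ltnn.
    + by move=> tl; have [] := tP l'; rewrite -tl ltnn.
    + by move=> _; apply: val_inj; rewrite /= kE lE !ord1.
  move=> k; rewrite /= mxE; case: (split k) => k'.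
    by have [tp ->] := tP k'; rewrite ltnW.
  by rewrite ltnSn mxE !ord1 eqxx mulr1n.
- move=> i z; rewrite (cone_count _ _ theta linG) cntF big_mkcond /=.
  rewrite [in RHS]big_mkcond /= (bigD1 p) //= ltnn /= add0n.
  rewrite [in RHS](bigD1 p) //= ltnSn /= addnC; congr (_ + _)%N.
  apply: eq_bigr => q qp.
  by rewrite ltnS [(q <= p)%N]leq_eqVlt (negPf (qp : q != p :> nat)).
Qed.

End Span.

(** * Linear forms *)

Section LinearForms.
Variables (K : fieldType) (n : nat).
Local Notation S := {mpoly K[n]}.

Lemma hom_deg_inj z z' (g : S) : g != 0 -> hom_deg z g -> hom_deg z' g -> z = z'.
Proof. by move=> g0 /(_ _ (mlead_supp g0)) <- /(_ _ (mlead_supp g0)). Qed.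

Lemma hom_degZ z c (g : S) : hom_deg z g -> hom_deg z (c *: g).
Proof.
move=> hg; rewrite -mul_mpolyC -[z]add0r; apply: hom_degM hg.
by apply: (@dhomog_hom_deg K n 0); rewrite -alg_mpolyC dhomogZ // dhomog1.
Qed.

Lemma hom_degB z (g h : S) : hom_deg z g -> hom_deg z h -> hom_deg z (g - h).
Proof.
by move=> hg hh; rewrite -(hcomp_id hg) -(hcomp_id hh) -raddfB;
  exact: hom_deg_hcomp.
Qed.

Lemma linear_formE (g : S) : hom_deg 1 g -> g = \sum_i g@_U_(i)%MM *: 'X_i.
Proof.
move=> hg; apply/mpolyP=> m; rewrite raddf_sum /=.
under eq_bigr do rewrite mcoeffZ mcoeffX.
have [/mdeg1P[i /eqP ->]|m1] := boolP (mdeg m == 1%N).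
  rewrite (bigD1 i) //= eqxx mulr1 big1 ?addr0 // => j /negPf ji.
  by rewrite eq_mnm1 ji mulr0.
rewrite (hom_degE hg) // big1 // => i _; case: eqP => [mi|_].
  by rewrite -mi mdeg1 in m1.
by rewrite mulr0.
Qed.

(** Congruence modulo an ideal respects products and sums, so it passes from variables to monomials
    and then to all polynomials. *)
Lemma comp_mpoly_congr (I : S -> Prop) (t : n.-tuple S) :
  is_ideal I -> (forall i, I (tnth t i - 'X_i)) -> forall g, I (g \mPo t - g).
Proof.
move=> idI It; have [I0 ID IM] := idI.
have mulI (a b a' b' : S) : I (a' - a) -> I (b' - b) -> I (a' * b' - a * b).
  move=> Ia Ib; have -> : a' * b' - a * b = b' * (a' - a) + a * (b' - b) by ring.
  by apply: ID; apply: IM.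
have monI m : I (('X_[m] : S) \mPo t - 'X_[m]).
  rewrite comp_mpolyX mpolyXE_id.
  apply: (big_ind2 (fun a b : S => I (a - b))) => [|a' a b' b|i _].
  - by rewrite subrr.
  - exact: mulI.
  - elim: (m i) => [|k IHk]; first by rewrite !expr0 subrr.
    by rewrite !exprS; apply: mulI.
elim/mpolyind=> [|c m p _ _ Ip]; first by rewrite comp_mpoly0 subrr.
rewrite comp_mpolyD comp_mpolyZ opprD addrACA -scalerBr -mul_mpolyC.
by apply: ID => //; apply: IM.
Qed.

(** * The Koszul resolution of independent linear forms *)

Section Koszul.
Variables (r : nat) (l : 'I_r -> S).
Hypothesis hl : forall t, hom_deg 1 (l t).
Hypothesis nred : nonredundant l.

(* A retraction of S onto a polynomial subring that is a section of S/J, where J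
   is generated by the first [p] linear forms; it shows that J is prime. *)
Lemma linear_retraction p : (p <= r)%N ->
  exists s : {lrmorphism S -> S},
    [/\ forall q : 'I_r, (q < p)%N -> s (l q) = 0,
        forall g, ideal_span (fun q : 'I_r => (q < p)%N) l (s g - g) &
        forall g, hom_deg 1 g -> hom_deg 1 (s g)].
Proof.
elim: p => [|p IHp] pr.
  exists (idfun : {lrmorphism S -> S}); split=> // g; rewrite /= subrr.
  by have [] := ideal_span_ideal l (fun q : 'I_r => (q < 0)%N).
have [s [s0 sid s1]] := IHp (ltnW pr).
pose o := Ordinal pr; set a := s (l o).
have a1 : hom_deg 1 a := s1 _ (@hl o).
(* Otherwise [l o] would be congruent to 0 modulo the earlier forms, hence redundant. *)
have a_neq0 : a != 0.
  apply/eqP=> a0; apply: (@nred o).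
  have := sid (l o); rewrite -/a a0 sub0r.
  case: (ideal_span_ideal l (fun q : 'I_r => (q < p)%N)) => _ _ IM.
  move/(IM (-1)); rewrite mulN1r opprK.
  apply: ideal_span_sub; first exact: ideal_span_ideal.
  by move=> q qp; apply: mem_ideal_span; rewrite /= -val_eqE neq_ltn qp.
have [i ai] : exists i, a@_U_(i)%MM != 0.
  apply/existsP; apply: contraNT a_neq0; rewrite negb_exists => /forallP ai0.
  rewrite (linear_formE a1) big1 // => i _.
  by move/negPn: (ai0 i) => /eqP ->; rewrite scale0r.
(* This substitution changes only the variable of index [i], by the multiple of [a] that makes it
   send the linear form [a] to [a - a = 0]. *)
pose t := [tuple (if j == i then 'X_j - (a@_U_(i)%MM)^-1 *: a else 'X_j : S) | j < n].
have tE j : tnth t j =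
    'X_j - (if j == i then (a@_U_(i)%MM)^-1 *: a else 0) :> S.
  by rewrite tnth_mktuple; case: eqP => _; rewrite ?subr0.
have tXE j : 'X_j \mPo t = tnth t j by rewrite comp_mpolyXU -tnth_nth.
have ta : a \mPo t = 0.
  rewrite {1}(linear_formE a1) raddf_sum /=.
  under eq_bigr => j _ do rewrite comp_mpolyZ tXE tE scalerBr.
  rewrite sumrB -(linear_formE a1) (bigD1 i) //= eqxx big1 => [|j /negPf ->].
    by rewrite addr0 scalerA mulfV // scale1r subrr.
  by rewrite scaler0.
have idJ := ideal_span_ideal l (fun q : 'I_r => (q < p.+1)%N).
have [_ JD JM] := idJ.
have subJ : forall g, ideal_span (fun q : 'I_r => (q < p)%N) l g ->
    ideal_span (fun q : 'I_r => (q < p.+1)%N) l g.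
  apply: ideal_span_sub => // q qp; apply: mem_ideal_span.
  by rewrite /= ltnW.
have Ja : ideal_span (fun q : 'I_r => (q < p.+1)%N) l a.
  rewrite -[a](subrK (l o)); apply: JD; first exact/subJ/sid.
  by apply: mem_ideal_span => /=.
exists (comp_mpoly t \o s : {lrmorphism S -> S}); split=> [q|g|g g1] /=.
- rewrite ltnS leq_eqVlt => /predU1P[qp|/s0 ->]; last exact: comp_mpoly0.
  by have -> : q = o by exact: val_inj.
- rewrite -(subrKA (s g)); apply: JD; last exact/subJ/sid.
  apply: comp_mpoly_congr => // j; rewrite tE addrAC subrr add0r -mulN1r.
  apply/JM; case: eqP => _; first by rewrite -mul_mpolyC; apply/JM.
  by case: idJ.
- rewrite (linear_formE (s1 _ g1)) raddf_sum /=; apply: hom_deg_sum => j _.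
  rewrite comp_mpolyZ tXE tE; apply: hom_degZ.
  have hX : hom_deg 1 ('X_j : S).
    by apply: (@dhomog_hom_deg K n 1); rewrite dhomogX; exact/eqP/mdeg1.
  apply: hom_degB hX _; case: eqP => _; last exact: hom_deg0.
  exact: hom_degZ.
Qed.

(** Applying the retraction [s] to a relation for [g * l p] kills the earlier forms. As S is a
    domain, either [s g = 0], which puts [g] in the ideal, or [s (l p) = 0], which makes [l p]
    redundant. *)
Lemma linear_forms_colon (p : 'I_r) g :
  ideal_span (fun q : 'I_r => (q < p)%N) l g <-> prev_colon l p g.
Proof.
have idJ := ideal_span_ideal l (fun q : 'I_r => (q < p)%N).
have [_ _ JM] := idJ.
split=> [Jg|]; first by rewrite /prev_colon /colon mulrC; apply: JM.
have [s [s0 sid _]] := linear_retraction (ltnW (ltn_ord p)).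
case=> c /(congr1 s); rewrite raddf_sum big1 => [|q qp]; last first.
  by rewrite /= rmorphM /= s0 ?mulr0.
move/eqP; rewrite rmorphM /= mulf_eq0 => /orP[/eqP sg0|/eqP sl0].
  by have /(JM (-1)) := sid g; rewrite sg0 sub0r mulN1r opprK.
case: (@nred p); have /(JM (-1)) := sid (l p).
rewrite sl0 sub0r mulN1r opprK; apply: ideal_span_sub.
  exact: ideal_span_ideal.
by move=> q qp; apply: mem_ideal_span; rewrite /= -val_eqE neq_ltn qp.
Qed.

Lemma nonredundant_neq0 t : l t != 0.
Proof.
apply/eqP=> lt0; apply: (@nred t); rewrite lt0.
by case: (ideal_span_ideal l (fun q => q != t)).
Qed.

Lemma deg_linear_form t : l t \is homog mdeg -> deg (l t) = 1%N.
Proof.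
move/homog_hom_deg => h; apply/eqP; rewrite -eqz_nat; apply/eqP.
exact: hom_deg_inj (nonredundant_neq0 t) h (@hl t).
Qed.

(** The left side totals the ranks added by the successive cones. *)
Lemma hockey_stick p i : (\sum_(q < p) 'C(q, i))%N = 'C(p, i.+1).
Proof.
elim: p => [|p IHp]; first by rewrite big_ord0 bin0n.
by rewrite big_ord_recr /= IHp binS.
Qed.

Lemma good_linear_resolution p F : (p <= r)%N ->
  (forall t, l t \is homog mdeg) ->
  good_resolution l (fun q => q) p F ->
  linear_resolution F (ideal_span (fun q : 'I_r => (q < p)%N) l) p.
Proof.
move=> pr homl [resF _ _ _ cnt].
have cnt1 i : #|[set k : 'I_(frank F i) | fshift k == i%:Z + 1]| = 'C(p, i.+1).
  rewrite cnt -hockey_stick (big_ord_widen _ (fun q => 'C(q, i)) pr).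
  by apply: eq_bigl => q; rewrite deg_linear_form // eqxx andbT.
(* Every linear form has degree 1, so outside the strand of degree 1 the count is an empty sum. *)
have shift1 i (k : 'I_(frank F i)) : fshift k = i.+1%:Z.
  apply/eqP; apply: contraT => k1; have := cnt i (fshift k - i%:Z).
  rewrite big_pred0 => [|q]; last first.
    rewrite deg_linear_form //; apply/negbTE; rewrite negb_and; apply/orP; right.
    by apply: contraNneq k1; lia.
  move/eqP; rewrite cards_eq0 => /eqP/setP/(_ k).
  by rewrite !inE addrC subrK eqxx.
split=> // i; rewrite -cnt1 -[LHS]card_ord -cardsT; congr #|pred_of_set _|.
by apply/setP=> k; rewrite !inE shift1; apply/esym/eqP; lia.
Qed.

Lemma koszul_resolution : (forall t, l t \is homog mdeg) ->
  exists G, linear_resolution G (ideal_span predT l) r.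
Proof.
move=> homl; suff [F goodF] : exists F, good_resolution l (fun q => q) r F.
  exists F; have [resF sh rk] := good_linear_resolution (leqnn r) homl goodF.
  split=> //; apply: resolution_ext resF => g.
  have E : (fun q : 'I_r => (q < r)%N) =1 predT by move=> q; rewrite ltn_ord.
  by split=> -[c ->]; exists c; rewrite (eq_bigl _ _ E).
suff: forall p, (p <= r)%N -> exists F, good_resolution l (fun q => q) p F by apply.
elim=> [|p IHp] pr; first by exists (zero_free_seq K n); exact: good_resolution0.
have [F goodF] := IHp (ltnW pr); pose o := Ordinal pr.
(* The colon ideal is the ideal already resolved, so [F] provides both ingredients of the cone. *)
apply: (good_resolution_step (p := o) nred (homl o) goodF).
have [resF sh rk] := good_linear_resolution (ltnW pr) homl goodF.
by split; [apply: resolution_ext resF; exact: (linear_forms_colon o)| |].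
Qed.

End Koszul.

(** The degree 1 components of a shortest homogeneous generating system still generate [L], because
    they yield all its linear forms; being [r] in number, none is redundant. *)
Lemma colon_linear_forms (L : S -> Prop) r :
  generated_by_linear_forms L -> is_min_number_generators L r -> ~ L 1 ->
  exists l : 'I_r -> S,
    [/\ forall t, l t \is 1.-homog, nonredundant l &
        forall g, L g <-> ideal_span predT l g].
Proof.
move=> [k [l0 [hl0 Ll0]]] [[g [hg Lg]] minr] L1.
pose l t := pihomog mdeg 1 (g t).
have hl t : l t \is 1.-homog by exact: pihomogP.
have idL : is_ideal L.
  have [I0 ID IM] := ideal_span_ideal g predT.
  split; [exact/Lg|by move=> a b /Lg La /Lg Lb; exact/Lg/ID|].
  by move=> s a /Lg La; exact/Lg/IM.
have Lgt t : L (g t) by apply/Lg; exact: mem_ideal_span.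
have gE t : l t = g t \/ l t = 0 /\ (deg (g t) != 1)%N.
  have [d1|d1] := eqVneq (deg (g t)) 1%N; [left|right; split=> //].
    by apply: pihomog_dE; rewrite -d1 -homog_msize.
  by apply: pihomog_ne0 d1 _; rewrite -homog_msize.
have [I0 ID IM] := ideal_span_ideal l predT.
have Ll a : L a <-> ideal_span predT l a.
  split=> [/Ll0|]; last first.
    apply: ideal_span_sub => // t _.
    by have [->|[-> _]] := gE t; [exact: Lgt|case: idL].
  apply: ideal_span_sub; first exact: ideal_span_ideal.
  move=> s _; have /Lg[c cE] : L (l0 s) by apply/Ll0; exact: mem_ideal_span.
  rewrite -(hcomp_id (dhomog_hom_deg (hl0 s))) cE raddf_sum /=.
  apply: ideal_sum => // t _; have hgt := homog_hom_deg (hg t).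
  have -> : pihomog mdeg 1 (c t * g t) =
      hcomp (1 - (deg (g t))%:Z + (deg (g t))%:Z) (c t * g t) by rewrite subrK.
  rewrite hcompMr //; have [<-|[_ d1]] := gE t.
    by apply: IM; exact: mem_ideal_span.
  (* A generator of degree at least 2 would need a coefficient of negative degree. *)
  have [d0|d0] := eqVneq (deg (g t)) 0%N; last first.
    case E : (1 - _) => [d|d]; first by exfalso; move: E d0 d1; lia.
    by rewrite mul0r.
  (* [deg] is 0 also at the zero polynomial; a nonzero constant in [L] would give [L 1]. *)
  have [->|gt0] := eqVneq (g t) 0; first by rewrite mulr0.
  case: L1; rewrite d0 in hgt; move: (Lgt t) gt0.
  rewrite (hom_deg0_const hgt) mpolyC_eq0 => Lc c0.
  have [_ _ LM] := idL; have := LM (((g t)@_0%MM)^-1)%:MP _ Lc.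
  by rewrite -mpolyCM mulVf.
exists l; split=> // p lp.
case: r g {hg Lg Lgt} minr l hl {gE I0 ID IM} Ll p lp =>
  [|r] g minr l hl Ll p lp.
  by case: p lp.
(* Dropping a redundant form would leave fewer generators than the minimum. *)
suff: (r.+1 <= r)%N by rewrite ltnn.
apply: (minr r (fun q => l (lift p q))); split=> [q|a]; first exact: homogE (hl _).
have idl := ideal_span_ideal (fun q => l (lift p q)) predT.
have ml q : q != p -> ideal_span predT (fun q => l (lift p q)) (l q).
  rewrite eq_sym => /unlift_some[q' -> _].
  exact: (mem_ideal_span (fun q => l (lift p q))).
rewrite Ll; split; apply: ideal_span_sub => //; last first.
- by move=> q _; exact: mem_ideal_span.
- exact: ideal_span_ideal.
move=> q _; have [->|/ml //] := eqVneq q p.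
by move: lp; apply: ideal_span_sub.
Qed.

End LinearForms.

(** * Linear quotients *)

Section LinearQuotients.
Variables (K : fieldType) (n m : nat) (f : 'I_m -> {mpoly K[n]}).
Variables (I : {mpoly K[n]} -> Prop) (N : 'I_m -> nat).

Lemma minimal_generators_nonredundant :
  minimal_homogeneous_generators I f -> nonredundant f.
Proof.
move=> [[_ If] minf] p fp; apply: (minf (setT :\ p)).
  by rewrite properD1 ?inE.
move=> g; rewrite If; split; last first.
  by apply: ideal_span_sub; [exact: ideal_span_ideal
                            |by move=> q _; exact: mem_ideal_span].
have idP := ideal_span_ideal f (mem (setT :\ p)).
have sub q : q != p -> ideal_span (mem (setT :\ p)) f (f q).
  by move=> qp; apply: mem_ideal_span; rewrite /= !inE qp.
apply: ideal_span_sub => // q _; have [->|] := eqVneq q p; last exact: sub.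
by move: fp; apply: ideal_span_sub.
Qed.

Lemma good_resolution_linear_quotients :
  minimal_homogeneous_generators I f -> linear_quotients I f ->
  (forall p, is_min_number_generators (prev_colon f p) (N p)) ->
  exists F, good_resolution f N m F.
Proof.
move=> hmin [_ hlq] hN; have nred := minimal_generators_nonredundant hmin.
have [[homf _] _] := hmin.
suff: forall p, (p <= m)%N -> exists F, good_resolution f N p F by apply.
elim=> [|p IHp] pm; first by exists (zero_free_seq K n); exact: good_resolution0.
have [F goodF] := IHp (ltnW pm); pose o := Ordinal pm.
have lin : generated_by_linear_forms (prev_colon f o).
  (* [linear_quotients] starts at the second generator. For the first one, the colon of the zero
     ideal by a nonzero polynomial is zero, generated by the empty family. *)
  have [p0|p_gt0] := posnP p; last exact: hlq.
  exists 0%N, (fun _ => 0); split=> [[]//|g].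
  have span0 (q : nat) (P : pred 'I_q) (h : 'I_q -> {mpoly K[n]}) a :
      P =1 pred0 -> ideal_span P h a <-> a = 0.
    move=> P0; split=> [[c ->]|->]; first by rewrite big_pred0.
    by exists (fun _ => 0); rewrite big_pred0.
  rewrite /prev_colon /colon !span0; [|by case|by move=> q; rewrite /= p0].
  split=> [/eqP|->]; last by rewrite mul0r.
  by rewrite mulf_eq0 (negPf (nonredundant_neq0 nred o)) orbF => /eqP.
(* A colon ideal containing 1 would make [f o] redundant. *)
have proper1 : ~ prev_colon f o 1.
  rewrite /prev_colon /colon mul1r => fo; apply: (@nred o); move: fo.
  apply: ideal_span_sub; first exact: ideal_span_ideal.
  by move=> q qo; apply: mem_ideal_span; rewrite /= -val_eqE neq_ltn qo.
have [l [hl nredl lE]] := colon_linear_forms lin (hN o) proper1.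
have [|G [resG sh rk]] := koszul_resolution (fun t => dhomog_hom_deg (hl t)) nredl.
  by move=> t; exact: homogE (hl t).
apply: (good_resolution_step (p := o) (G := G) nred (homf o) goodF).
by split=> //; apply: resolution_ext resG => g; rewrite lE.
Qed.

End LinearQuotients.

Theorem corollary2p7 (K : fieldType) (n m : nat) (I : {mpoly K[n]} -> Prop)
    (f : 'I_m -> {mpoly K[n]}) (nq : 'I_m -> nat)
    (hI : homogeneous_ideal I)
    (hmin : minimal_homogeneous_generators I f)
    (hlq : linear_quotients I f)
    (hnq : forall p : 'I_m, is_min_number_generators (prev_colon f p) (nq p)) :
  [/\ (0 < m)%N -> is_regularity I (\max_(p < m) deg (f p))%N%:Z,
      (0 < m)%N -> is_projective_dimension I (\max_(p < m) nq p)%N,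
      (forall (i : nat) (j : int),
         betti I i (i%:Z + j) =
         (\sum_(p < m | (deg (f p))%:Z == j) 'C(nq p, i))%N) &
      (forall i : nat, is_total_betti I i (\sum_(p < m) 'C(nq p, i))%N)].
Proof.
have [F [resJ minF _ _ cnt]] := good_resolution_linear_quotients hmin hlq hnq.
have resF : is_graded_free_resolution F I.
  apply: resolution_ext resJ => g; have [[_ ->] _] := hmin.
  have E : (fun q : 'I_m => (q < m)%N) =1 predT by move=> q; rewrite ltn_ord.
  by split=> -[c ->]; exists c; rewrite (eq_bigl _ _ E).
have cntF i (j : int) : #|[set k : 'I_(frank F i) | fshift k == i%:Z + j]| =
    (\sum_(p < m | (deg (f p))%:Z == j) 'C(nq p, i))%N.
  by rewrite cnt; apply: eq_bigl => p; rewrite ltn_ord.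
have bettiE i (j : int) : betti I i (i%:Z + j) =
    (\sum_(p < m | (deg (f p))%:Z == j) 'C(nq p, i))%N.
  by rewrite (betti_minimal _ _ resF).
have betti_neq0 i (j : int) : betti I i (i%:Z + j) <> 0%N ->
    exists p, (deg (f p))%:Z = j.
  case: (pickP (fun p => (deg (f p))%:Z == j)) => [p /eqP pj _|none].
    by exists p.
  by rewrite bettiE big_pred0.
split=> // [m0|m0|i].
- have [|p0 maxE] := @bigop.eq_bigmax 'I_m (fun p => deg (f p)).
    by rewrite card_ord.
  split.
    (* In homological degree 0 each binomial is 1, so the largest degree does occur. *)
    exists 0%N; rewrite bettiE maxE; apply/eqP.
    by rewrite (bigD1 p0) //= bin0.
  move=> i j /betti_neq0[p <-]; rewrite lez_nat.
  exact: (@bigop.leq_bigmax 'I_m (fun p => deg (f p))).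
- have [|p0 maxE] := @bigop.eq_bigmax 'I_m nq; first by rewrite card_ord.
  split.
    apply: (free_projective_resolution resF) => i iN; apply/eqP.
    rewrite -leqn0 leqNgt; apply/negP=> F0; pose k := Ordinal F0.
    (* A basis element beyond the bound would be counted in its own strand, where every binomial
       vanishes. *)
    have := cntF i (fshift k - i%:Z); rewrite addrC subrK big1 => [|p _].
      by move/eqP; rewrite cards_eq0 => /eqP/setP/(_ k); rewrite !inE eqxx.
    by apply: bin_small; apply: leq_ltn_trans iN; exact: (@bigop.leq_bigmax 'I_m nq).
  move=> d; apply: (projective_resolution_length resF minF).
  set M := (\max_(p < m) nq p)%N in maxE *.
  (* The generator [p0] attaining the maximum contributes ['C(M, M) = 1], so F_M is nonzero. *)
  have : (#|[set k : 'I_(frank F M) |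
      fshift k == (M%:Z + (deg (f p0))%:Z)%R]| <= frank F M)%N.
    by apply: leq_trans (max_card _) _; rewrite card_ord.
  by rewrite cntF (bigD1 p0) //= -maxE binn; apply: leq_trans.
- exists (undup [seq (deg (f p))%:Z | p : 'I_m]); split.
  + exact: undup_uniq.
  + by move=> j /betti_neq0[p <-]; rewrite mem_undup; apply: image_f.
  + under eq_bigr do rewrite bettiE big_mkcond /=.
    (* Each generator now contributes at exactly one [j], its own degree. *)
    rewrite exchange_big /=; apply: eq_bigr => p _.
    rewrite (bigD1_seq (deg (f p))%:Z) ?undup_uniq //=; last first.
      by rewrite mem_undup; apply: image_f.
    rewrite eqxx big1 ?addn0 // => j jp.
    by rewrite eq_sym (negPf jp).
Qed.
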